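(* Let $E\subset\mathbb{C}$ be a compact set with $\mathrm{cap}(E)=1$, symmetric with respect to the origin (i.e. $E=-E$), whose Green function satisfies the H\''older condition: there are constants $C(E)>0$ and $0<s\le1$ such that $$g_E(z,\infty)\le C(E)\,(d_E(z))^s,\qquad z\in\Omega_E.$$ Let $M>0$ be a fixed number. If $P_n(z)=a_n\prod_{k=1}^n(z-z_{k,n})\in\mathbb{Z}_n^s(E,M)$, then $$\left|\frac1n\sum_{k=1}^n z_{k,n}\right|\le C_7\sqrt{\frac{\log n}{n}},\qquad n\ge\max(M,2),$$ where $C_7>0$ does not depend on $P_n$ (nor on $n$).
   Context: For a Borel measure $\mu$ with compact support in $\mathbb{C}$, its energy is $I[\mu]=\iint\log\frac{1}{|z-t|}\,d\mu(t)\,d\mu(z)$. For compact $E\subset\mathbb{C}$, let $\mathcal{M}(E)$ be the set of all Borel probability measures supported on $E$; Robin's constant is $V_E=\inf_{\mu\in\mathcal{M}(E)}I[\mu]$ and the capacity is $\mathrm{cap}(E)=e^{-V_E}$. If $\mathrm{cap}(E)>0$, the infimum is attained by a unique measure $\mu_E\in\mathcal{M}(E)$, the equilibrium measure of $E$. $\Omega_E$ is the unbounded connected component of $\overline{\mathbb{C}}\setminus E$, and $g_E(z,\infty)$ is the Green function of $\Omega_E$ with pole at $\infty$; for $z\in\Omega_E\setminus\{\infty\}$ it equals $g_E(z,\infty)=V_E-\int\log\frac{1}{|z-t|}\,d\mu_E(t)$. The distance to $E$ is $d_E(z)=\min_{t\in E}|z-t|$ (the H\''older condition concerns finite points $z\in\Omega_E$).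 $\mathbb{Z}_n^s(E,M)$ (the superscript $s$ stands for ''simple'' and is unrelated to the H\''older exponent) is the class of polynomials $P_n(z)=a_nz^n+\ldots$ of degree $n$ with integer coefficients, all of whose zeros are simple and lie in $E$, and whose leading coefficient satisfies $0<|a_n|\le M$. *)

(* Defs.v *)
From HB Require Import structures.
From mathcomp Require Import all_boot all_order all_algebra.
From mathcomp Require Import complex.
From mathcomp Require Import all_classical all_reals all_analysis.

Set Implicit Arguments.
Unset Strict Implicit.
Unset Printing Implicit Defensive.

Import Order.TTheory GRing.Theory Num.Theory.
Import numFieldNormedType.Exports.

Local Open Scope classical_set_scope.
Local Open Scope ring_scope.

(* [R[i]] seen as an abstract [numClosedFieldType]: the topology that the
   library puts on every numFieldType is found through this coercion and is not
   inferred on the bare type [R[i]].  The norm [`|z|] of this structure takes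
   its values in [R[i]]; the modulus as an element of [R] is [cmod]. *)
Definition CC (R : realType) : numClosedFieldType := R[i]%C.

Definition cmod (R : realType) (z : CC R) : R := Normc.normc z.

Definition borelC (R : realType) := g_sigma_algebraType (@open (CC R)).

(* The integral is a Lebesgue integral with values in [\bar R]; as
   [lne 0 = -oo], the integrand log (1 / |z - t|) is [+oo] at t = z. *)
Definition log_potential (R : realType) (mu : probability (borelC R) R)
    (z : CC R) : \bar R :=
  (\int[mu]_t - lne (cmod (z - t))%:E)%E.

Definition energy (R : realType) (mu : probability (borelC R) R) : \bar R :=
  (\int[mu]_z log_potential mu z)%E.

(* Only used for closed [E], where it says that the support of the measure is
   contained in [E]. *)
Definition prob_on (R : realType) (E : set (CC R)) :
    set (probability (borelC R) R) :=
  [set mu | mu (~` E) = 0%E].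

Definition robin (R : realType) (E : set (CC R)) : \bar R :=
  ereal_inf [set energy mu | mu in prob_on E].

Definition capacity (R : realType) (E : set (CC R)) : \bar R :=
  expeR (- robin E)%E.

Definition is_equilibrium_measure (R : realType) (E : set (CC R))
    (mu : probability (borelC R) R) : Prop :=
  prob_on E mu /\ energy mu = robin E.

(* The one-point compactification of the plane is the Riemann sphere, in which
   [None] is the point at infinity and [Some z] the finite point [z]. *)
Definition Omega (R : realType) (E : set (CC R)) :
    set (one_point_compactification (CC R)) :=
  connected_component (~` (Some @` E) : set (one_point_compactification (CC R)))
    None.

(* [g] is the Green function of [Omega E] with pole at infinity: at the finite
   points of [Omega E] it is Robin's constant minus the logarithmic potential of
   the equilibrium measure.  Its values elsewhere are irrelevant.  For compact
   [E] of positive capacity the measure [mu] exists and is unique. *)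
Definition is_green_function (R : realType) (E : set (CC R))
    (g : CC R -> \bar R) : Prop :=
  exists2 mu : probability (borelC R) R, is_equilibrium_measure E mu &
    forall z : CC R, Omega E (Some z) -> g z = (robin E - log_potential mu z)%E.

Definition dist_to (R : realType) (E : set (CC R)) (z : CC R) : R :=
  inf [set cmod (z - t) | t in E].

Definition polyC_of_int (R : realType) (P : {poly int}) : {poly CC R} :=
  map_poly (fun a : int => a%:~R) P.

(* The class Z_n^s(E, M); [mup w Q] is the multiplicity of [w] as a root
   of [Q]. *)
Definition simple_int_poly (R : realType) (n : nat) (E : set (CC R)) (M : R)
    (P : {poly int}) : Prop :=
  [/\ size P = n.+1,
      forall w : CC R, root (polyC_of_int R P) w ->
        E w /\ mup w (polyC_of_int R P) = 1%N,
      (0 < `|lead_coef P|) &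
      (`|lead_coef P|%:~R <= M)].

(* Main.v *)
(* For the empirical measure nu of the zeros and the equilibrium measure mu, the
   signed measure sigma = nu - mu has energy O(log n / n) after regularising the
   logarithm at a scale d that is a power of 1/n: the zeros contribute at most
   (log (1/d) + O(1)) / n because the resultant of P and P' is a nonzero integer,
   mu contributes Robin's constant, and the mixed term is controlled because the
   Hoelder condition bounds the potential of mu from below near E.  On the other
   hand the energy dominates |int z dsigma|^2.  With -z_k in place of z_k (this is
   where E = -E enters) both the mean of the zeros and its opposite are close to
   int z dmu, so the mean is small and int z dmu need not be computed.

   The regularised kernel is, in the unit disc,
     -(1/2) log (|x - y|^2 + d^2 (1 - |x|^2) (1 - |y|^2)).
   It lies below -log |x - y|, is strictly superharmonic in x, and dominates
   Re (x conj y) as a positive definite kernel, because its argument factors as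
     |1 - x conj y|^2 (1 - (1 - d^2) (1 - |x|^2) (1 - |y|^2) / |1 - x conj y|^2).
   The measure mu is discretised before the kernel is used, so only finite
   quadratic forms and finite sums of kernels occur.  *)

Require Import Defs.
From HB Require Import structures.
From mathcomp Require Import all_boot all_order all_algebra.
From mathcomp Require Import complex.
From mathcomp Require Import all_classical all_reals all_analysis.
From mathcomp Require Import measurable_realfun ring lra zify.

Set Implicit Arguments.
Unset Strict Implicit.
Unset Printing Implicit Defensive.

Import Order.TTheory GRing.Theory Num.Theory.
Import numFieldNormedType.Exports.

Local Open Scope classical_set_scope.
Local Open Scope ring_scope.

(** * The complex plane *)

Section ComplexModulus.
Context {R : realType}.
Implicit Types x y z : CC R.

Definition rc (a : R) : CC R := (a +i* 0)%C.

Lemma cmod_norm z : `|z| = rc (cmod z).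
Proof. by []. Qed.

Lemma cmod_sqr z : cmod z ^+ 2 = complex.Re z ^+ 2 + complex.Im z ^+ 2.
Proof. by case: z => a b; rewrite /cmod /= sqr_sqrtr// addr_ge0// sqr_ge0. Qed.

Lemma cmod_ge0 z : 0 <= cmod z.
Proof. by case: z => a b; exact: sqrtr_ge0. Qed.

Lemma rc_le (a b : R) : (rc a <= rc b) = (a <= b).
Proof. exact: lecR. Qed.

Lemma rc_lt (a b : R) : (rc a < rc b) = (a < b).
Proof. exact: ltcR. Qed.

Lemma rcM (a b : R) : rc (a * b) = rc a * rc b.
Proof. exact: (rmorphM (real_complex R)). Qed.

Lemma rcD (a b : R) : rc (a + b) = rc a + rc b.
Proof. exact: (rmorphD (real_complex R)). Qed.

Lemma rcX (a : R) n : rc (a ^+ n) = rc a ^+ n.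
Proof. exact: (rmorphXn (real_complex R)). Qed.

Lemma rcV (a : R) : rc a^-1 = (rc a)^-1.
Proof. exact: (fmorphV (real_complex R)). Qed.

Lemma cmodM x y : cmod (x * y) = cmod x * cmod y.
Proof. exact: Normc.normcM. Qed.

Lemma cmod_rc a : cmod (rc a) = `|a|.
Proof. by rewrite /cmod /= expr0n /= addr0 sqrtr_sqr. Qed.

Lemma cmod0 : cmod (0 : CC R) = 0.
Proof. by rewrite -[0]/(rc 0) cmod_rc normr0. Qed.

Lemma cmod1 : cmod (1 : CC R) = 1.
Proof. by rewrite -[1]/(rc 1) cmod_rc normr1. Qed.

Lemma cmodi (a : R) : cmod (0 +i* a)%C = `|a|.
Proof. by rewrite /cmod /= expr0n /= add0r sqrtr_sqr. Qed.

Lemma normr_Re_le z : `|complex.Re z| <= cmod z.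
Proof. by rewrite -rc_le -cmod_norm; exact: normc_ge_Re. Qed.

Lemma normr_Im_le z : `|complex.Im z| <= cmod z.
Proof.
by case: z => u v; rewrite /cmod /= -sqrtr_sqr ler_wsqrtr// lerDr sqr_ge0.
Qed.

Lemma cmodD x y : cmod (x + y) <= cmod x + cmod y.
Proof. exact: (@le_normcD R x y). Qed.

Lemma cmod_sum (I : Type) (r : seq I) (f : I -> CC R) :
  cmod (\sum_(i <- r) f i) <= \sum_(i <- r) cmod (f i).
Proof.
elim/big_rec2 : _ => [|i y x _ xy]; first by rewrite cmod0.
by rewrite (le_trans (cmodD _ _))// lerD2l.
Qed.

Lemma cmodN x : cmod (- x) = cmod x.
Proof. exact: (@normcN R x). Qed.

Lemma cmodB x y : cmod (x - y) = cmod (y - x).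
Proof. by rewrite -cmodN opprB. Qed.

Lemma cmod_eq0 x : (cmod x == 0) = (x == 0).
Proof.
apply/eqP/eqP => [/Normc.eq0_normc//|->].
exact: cmod0.
Qed.

Lemma cmod_gt0 x : (0 < cmod x) = (x != 0).
Proof. by rewrite lt_neqAle eq_sym cmod_eq0 cmod_ge0 andbT. Qed.

Lemma cmod_triangle y x z : cmod (x - z) <= cmod (x - y) + cmod (y - z).
Proof. by rewrite -[x - z](subrKA y) cmodD. Qed.

Lemma nbhs_cmodP z (A : set (CC R)) :
  nbhs z A <-> exists2 e : R, 0 < e & forall w, cmod (w - z) < e -> A w.
Proof.
split => [/nbhs_ballP[e /= e0 eA]|[e e0 eA]].
  case: e e0 eA => e e' /[dup]; rewrite {1}ltcE /= => /andP[/eqP -> e0] _ eA.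
  exists e => // w wz; apply: eA; rewrite /ball /= distrC cmod_norm.
  by rewrite -[X in _ < X]/(rc e) rc_lt.
apply/nbhs_ballP; exists (rc e); first by rewrite /= -[0]/(rc 0) rc_lt.
by move=> w; rewrite /ball /= distrC cmod_norm rc_lt; exact: eA.
Qed.

Lemma open_cmod_ball z (e : R) : open ([set w | cmod (w - z) < e] : set (CC R)).
Proof.
rewrite openE => w /= wz; apply/nbhs_cmodP; exists (e - cmod (w - z)).
  by rewrite subr_gt0.
by move=> v vw /=; rewrite (le_lt_trans (cmod_triangle w v z))// -ltrBrDr.
Qed.

Lemma compact_closedC (E : set (CC R)) : compact E -> closed E.
Proof. by move=> cE; apply: compact_closed => //; exact: norm_hausdorff. Qed.

Lemma compact_finite_net (E : set (CC R)) (e : R) : compact E -> 0 < e ->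
  exists s : seq (CC R), (forall p, p \in s -> E p) /\
    forall t, E t -> exists2 p, p \in s & cmod (t - p) < e.
Proof.
move=> + e0; rewrite compact_cover.
move=> /(_ _ E (fun p => [set w | cmod (w - p) < e])).
case=> [p _|t Et|s sE cov]; first exact: open_cmod_ball.
  exists t => //=; rewrite subrr cmod0//.
exists (finmap.enum_fset s); split.
  by move=> p ps; have := sE p ps; rewrite inE.
by move=> t /cov[p /= ps tp]; exists p.
Qed.

Lemma compact_cmod_bounded (E : set (CC R)) : compact E ->
  exists2 rho : R, 0 < rho & forall t, E t -> cmod t < rho.
Proof.
move=> cE; have [s [_ sE]] := compact_finite_net cE ltr01.
exists (1 + \sum_(p <- s) cmod p).
  by rewrite ltr_pwDl// sumr_ge0// => p _; exact: cmod_ge0.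
move=> t /sE[p ps tp].
rewrite -[t](subrK p) (le_lt_trans (cmodD _ _))// ltr_leD//.
by rewrite (big_rem p)//= lerDl sumr_ge0// => q _; exact: cmod_ge0.
Qed.

Lemma borelC_open (A : set (CC R)) :
  open A -> measurable (A : set (borelC R)).
Proof. by move=> oA; exact: sub_sigma_algebra. Qed.

Lemma compact_measurableC (E : set (CC R)) :
  compact E -> measurable (E : set (borelC R)).
Proof.
move=> /compact_closedC/closed_openC/borelC_open/measurableC.
by rewrite setCK.
Qed.

Lemma fine_partition (E : set (CC R)) (e : R) : compact E -> 0 < e ->
  exists (N : nat) (b : 'I_N -> CC R) (B : 'I_N -> set (borelC R)),
  [/\ forall i, E (b i), forall i, measurable (B i),
      forall i j x, B i x -> B j x -> i = j,
      forall x, E x -> exists i, B i x &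
      forall i x, B i x -> cmod (x - b i) < e].
Proof.
move=> cE e0; have [s [sE cov]] := compact_finite_net cE e0.
pose F i : set (borelC R) := [set w | cmod (w - nth 0 s i) < e].
exists (size s), (fun i => nth 0 s i), (fun i => seqDU F i); split => //.
- by move=> i; apply: sE; rewrite mem_nth.
- move=> i; apply: measurableD; first by apply: borelC_open; exact: open_cmod_ball.
  by apply: bigsetU_measurable => k _; apply: borelC_open; exact: open_cmod_ball.
- move=> i j x Bi Bj; apply/val_inj.
  by apply: (@trivIset_seqDU _ F _ _ Logic.I Logic.I); exists x.
- move=> x /cov[p ps xp].
  have : (\big[setU/set0]_(i < size s) F i) x.
    rewrite -bigcup_mkord; exists (index p s) => /=; rewrite ?index_mem//.
    by rewrite /F /= nth_index.
  rewrite bigsetU_seqDU -bigcup_mkord => -[i /= iN Bi].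
  by exists (Ordinal iN).
- by move=> i x [].
Qed.

End ComplexModulus.

(** * Positivity of the regularised logarithmic kernel *)

Section LogDerivatives.
Context {R : realType}.

Lemma is_derive_log_quadratic (a b s : R) : 0 < 1 - 2 * s * a + s ^+ 2 * b ->
  is_derive s 1 (fun t : R => - ln (1 - 2 * t * a + t ^+ 2 * b) / 2 - t * a)
   ((a - s * b) / (1 - 2 * s * a + s ^+ 2 * b) - a).
Proof.
pose q t : R := 1 - 2 * t * a + t ^+ 2 * b.
rewrite -[1 - _ + _]/(q s) => q0.
have dq : is_derive s 1 q (- (2 * a) + 2 * s * b).
  have -> : q = (cst 1 \- (2 * a) \*: id) \+ b \*: (@GRing.exp R ^~ 2%N).
    by apply/funext => t /=; rewrite /q /GRing.scale /=; ring.
  by apply: is_derive_eq; rewrite /GRing.scale /=; ring.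
have dl := is_derive1_comp (is_derive1_ln q0) dq.
have -> : (fun t : R => - ln (1 - 2 * t * a + t ^+ 2 * b) / 2 - t * a)
    = ((- 2^-1) \*: (ln (R:=R) \o q)) \- (a \*: id).
  by apply/funext => t /=; rewrite /q /GRing.scale /=; ring.
apply: is_derive_eq; rewrite /GRing.scale /=.
by field; rewrite gt_eqF.
Qed.

Lemma is_derive_log_linear (a s : R) : 0 < 1 - s * a ->
  is_derive s 1 (fun t : R => - ln (1 - t * a) / 2) (a / (1 - s * a) / 2).
Proof.
pose q t : R := 1 - t * a.
rewrite -[1 - _]/(q s) => q0.
have dq : is_derive s 1 q (- a).
  have -> : q = cst 1 \- a \*: id.
    by apply/funext => t /=; rewrite /q /GRing.scale /=; ring.
  by apply: is_derive_eq; rewrite /GRing.scale /=; ring.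
have dl := is_derive1_comp (is_derive1_ln q0) dq.
have -> : (fun t : R => - ln (1 - t * a) / 2) = (- 2^-1) \*: (ln (R:=R) \o q).
  by apply/funext => t /=; rewrite /q /GRing.scale /=; ring.
apply: is_derive_eq; rewrite /GRing.scale /=.
by field; rewrite gt_eqF.
Qed.

End LogDerivatives.

Section PositiveKernels.
Context {R : realType} (N : nat).
Local Notation Re := (@complex.Re R).
Local Notation kernel := ('I_N -> 'I_N -> CC R).
Implicit Types (A B w : kernel) (c f : 'I_N -> CC R).

Definition form c A : CC R := \sum_i \sum_j c i * (c j)^* * A i j.

Definition psd A := forall c, 0 <= Re (form c A).

Lemma ReD (x y : CC R) : Re (x + y) = Re x + Re y.
Proof. exact: raddfD. Qed.

Lemma ge_Re_cmod (x : CC R) : - cmod x <= Re x.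
Proof.
by rewrite lerNl (le_trans _ (normr_Re_le x))// -normrN ler_norm.
Qed.

Lemma eq_psd A B : (forall i j, A i j = B i j) -> psd A -> psd B.
Proof.
move=> AB Ap c; rewrite -[form c B](_ : form c A = _)//.
by apply: eq_bigr => i _; apply: eq_bigr => j _; rewrite AB.
Qed.

Lemma psd1 : psd (fun _ _ => 1).
Proof.
move=> c; have -> : form c (fun _ _ => 1) = (\sum_i c i) * (\sum_i c i)^*.
  rewrite /form mulr_suml; apply: eq_bigr => i _.
  by rewrite rmorph_sum mulr_sumr; apply: eq_bigr => j _; rewrite mulr1.
by rewrite -normCK cmod_norm -rcX exprn_ge0// cmod_ge0.
Qed.

Lemma psdD A B : psd A -> psd B -> psd (fun i j => A i j + B i j).
Proof.
move=> Ap Bp c; have -> : form c (fun i j => A i j + B i j) = form c A + form c B.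
  rewrite /form -big_split; apply: eq_bigr => i _ /=.
  by rewrite -big_split; apply: eq_bigr => j _ /=; rewrite mulrDr.
by rewrite ReD addr_ge0.
Qed.

Lemma psd_weight f A : psd A -> psd (fun i j => f i * (f j)^* * A i j).
Proof.
move=> Ap c; have := Ap (fun i => c i * f i); congr (_ <= Re _).
apply: eq_bigr => i _; apply: eq_bigr => j _.
by rewrite rmorphM /=; ring.
Qed.

Lemma psd_conj_weight f A : psd A -> psd (fun i j => (f i)^* * f j * A i j).
Proof.
move=> /(psd_weight (fun i => (f i)^*)); apply: eq_psd => i j.
by rewrite conjCK.
Qed.

Lemma psd_scale (a : R) A : 0 <= a -> psd A -> psd (fun i j => rc a * A i j).
Proof.
move=> a0 /(psd_weight (fun=> rc (Num.sqrt a))); apply: eq_psd => i j.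
congr (_ * _); rewrite -[(rc _)^*]/(conjc _) conjc_real -rcM.
by rewrite -expr2 sqr_sqrtr.
Qed.

Definition stable w := forall A, psd A -> psd (fun i j => w i j * A i j).

Lemma geo_nonneg (X C q : R) : 0 <= q < 1 -> (forall k, 0 <= X + C * q ^+ k) ->
  0 <= X.
Proof.
move=> /andP[q0 q1] H.
have cv : (fun k => X + geometric C q k) @ \oo --> X + 0.
  by apply: cvgD; [exact: cvg_cst|apply: cvg_geometric; rewrite ger0_norm].
rewrite addr0 in cv; rewrite -(cvg_lim _ cv)//.
by apply: limr_ge; [apply/cvg_ex; exists X|apply: nearW => k; exact: H].
Qed.

Lemma stable_geometric w : stable w -> (forall i j, cmod (w i j) < 1) ->
  stable (fun i j => (1 - w i j)^-1).
Proof.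
move=> sw w1 A Ap c.
pose S k i j := \sum_(l < k) w i j ^+ l * A i j.
have Sp k : psd (S k).
  have wAp l : psd (fun i j => w i j ^+ l * A i j).
    elim: l => [|l /sw]; first by apply: eq_psd Ap => i j; rewrite mul1r.
    by apply: eq_psd => i j; rewrite exprS mulrA.
  elim: k => [|k IH]; last first.
    apply: eq_psd (psdD IH (wAp k)) => i j.
    by rewrite /S big_ord_recr.
  move=> d; rewrite -[form d _](_ : 0 = _)//.
  by rewrite /form big1// => i _; rewrite big1// => j _; rewrite /S big_ord0 mulr0.
have w1' i j : 1 - w i j != 0.
  rewrite subr_eq0; apply: contraTneq (w1 i j) => <-.
  by rewrite cmod1 ltxx.
pose q := \big[Num.max/0]_i \big[Num.max/0]_j cmod (w i j).
have q0 : 0 <= q by rewrite /q; elim/big_rec : _ => // i x _ x0; rewrite le_max x0 orbT.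
have wq i j : cmod (w i j) <= q.
  apply: le_trans (le_bigmax _ _ i).
  exact: (le_bigmax _ (fun j => cmod (w i j)) j).
have q1 : q < 1 by do 2 (apply/bigmax_ltP; split => // ? _).
pose C := \sum_i \sum_j cmod (c i * (c j)^* * ((1 - w i j)^-1 * A i j)).
apply: (@geo_nonneg _ C q); rewrite ?q0 ?q1// => k.
have -> : form c (fun i j => (1 - w i j)^-1 * A i j) = form c (S k) +
    \sum_i \sum_j w i j ^+ k * (c i * (c j)^* * ((1 - w i j)^-1 * A i j)).
  rewrite /form -big_split; apply: eq_bigr => i _ /=.
  rewrite -big_split; apply: eq_bigr => j _ /=.
  rewrite /S -mulr_suml.
  have -> : \sum_(l < k) w i j ^+ l = (1 - w i j ^+ k) / (1 - w i j).
    apply: (mulIf (w1' i j)); rewrite divfK// -[in RHS]opprB subrX1.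
    by rewrite mulrC -mulNr opprB.
  by field.
rewrite ReD -addrA addr_ge0 ?Sp// -lerBlDr sub0r.
apply: le_trans (ge_Re_cmod _); rewrite lerN2 /C.
rewrite mulr_suml (le_trans (cmod_sum _ _))// ler_sum// => i _.
rewrite mulr_suml (le_trans (cmod_sum _ _))// ler_sum// => j _.
rewrite cmodM mulrC ler_wpM2l ?cmod_ge0//.
elim: k => [|k IH]; first by rewrite !expr0 cmod1.
by rewrite !exprS cmodM ler_pM ?cmod_ge0.
Qed.

End PositiveKernels.

Section LogKernel.
Context {R : realType}.
Local Notation Re := (@complex.Re R).
Implicit Types x y : CC R.

Definition chord (d : R) x y : R :=
  cmod (x - y) ^+ 2 + d ^+ 2 * ((1 - cmod x ^+ 2) * (1 - cmod y ^+ 2)).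

Definition logker (d : R) x y : R := - ln (chord d x y) / 2.

Lemma cmod2_lt1 x : cmod x < 1 -> 0 < 1 - cmod x ^+ 2.
Proof. by move=> x1; rewrite subr_gt0 expr_lt1 ?cmod_ge0. Qed.

Lemma chord_gt0 (d : R) x y : 0 < d -> cmod x < 1 -> cmod y < 1 -> 0 < chord d x y.
Proof.
move=> d0 x1 y1; rewrite /chord ltr_wpDl ?sqr_ge0//.
by rewrite !mulr_gt0 ?exprn_gt0// cmod2_lt1.
Qed.

Lemma le01_of_derive (f df : R -> R) :
  (forall s : R, 0 <= s <= 1 -> is_derive s 1 f (df s)) ->
  (forall s : R, 0 <= s <= 1 -> 0 <= df s) -> f 0 <= f 1.
Proof.
move=> fd df0.
have [||s s01 e] := @MVT_segment R f df 0 1 ler01.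
- by move=> s; rewrite in_itv /= => /andP[s0 s1]; apply: fd; rewrite !ltW.
- apply: derivable_within_continuous => s; rewrite in_itv /= => s01.
  by have [] := fd _ s01.
- by rewrite -subr_ge0 e subr0 mulr1 df0// -in_itv.
Qed.

Variable N : nat.
Variables (x : 'I_N -> CC R) (c : 'I_N -> R).
Hypothesis x1 : forall i, cmod (x i) < 1.

Let quad (F : 'I_N -> 'I_N -> R) := \sum_i \sum_j c i * c j * F i j.

Let quadE (A : 'I_N -> 'I_N -> CC R) (F : 'I_N -> 'I_N -> R) :
  psd A -> (forall i j, Re (A i j) = F i j) -> 0 <= quad F.
Proof.
move=> /(_ (fun i => rc (c i))) + AF; congr (_ <= _).
rewrite /form /quad raddf_sum; apply: eq_bigr => i _ /=.
rewrite raddf_sum; apply: eq_bigr => j _ /=.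
rewrite -AF -[(rc _)^*]/(conjc _) conjc_real -rcM.
by case: (A i j) => u v /=; rewrite mul0r subr0.
Qed.

Let quad_derive (F dF : R -> 'I_N -> 'I_N -> R) :
  (forall i j (s : R), 0 <= s <= 1 -> is_derive s 1 (F ^~ i ^~ j) (dF s i j)) ->
  (forall s : R, 0 <= s <= 1 -> 0 <= quad (dF s)) -> quad (F 0) <= quad (F 1).
Proof.
move=> Fd dF0.
apply: (@le01_of_derive (fun s => quad (F s)) (fun s => quad (dF s))) => //.
move=> s s01; rewrite /quad.
have -> : (fun s => \sum_i \sum_j c i * c j * F s i j) =
    \sum_i \sum_j ((c i * c j) \*: (F ^~ i ^~ j)).
  apply/funext => t; rewrite fct_sumE; apply: eq_bigr => i _.
  by rewrite fct_sumE; apply: eq_bigr.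
apply: is_derive_sum => i; apply: is_derive_sum => j.
exact: (is_deriveZ (c i * c j) (Fd i j s s01)).
Qed.

Let w i j := x i * (x j)^*.
Let a i j := Re (w i j).
Let b i j := cmod (x i) ^+ 2 * cmod (x j) ^+ 2.
Let D i j (s : R) : R := 1 - 2 * s * a i j + s ^+ 2 * b i j.
Let h i j : R := (1 - cmod (x i) ^+ 2) * (1 - cmod (x j) ^+ 2) / D i j 1.

Let conjcE (z : CC R) : z^* = (complex.Re z +i* - complex.Im z)%C.
Proof. by case: z. Qed.

Let cmodwE i j : cmod (w i j) = cmod (x i) * cmod (x j).
Proof.
rewrite /w cmodM conjcE; congr (_ * _).
by case: (x j) => u v; rewrite /cmod /= sqrrN.
Qed.

Let bE i j : b i j = Re (w i j) ^+ 2 + complex.Im (w i j) ^+ 2.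
Proof. by rewrite -cmod_sqr cmodwE exprMn. Qed.

Let cmodw i j : cmod (w i j) < 1.
Proof. by rewrite cmodwE (le_lt_trans _ (x1 i))// ler_piMr ?cmod_ge0// ltW. Qed.

Let DE i j (s : R) : D i j s = cmod (1 - rc s * w i j) ^+ 2.
Proof.
rewrite cmod_sqr /D bE /a; case: (w i j) => u v /=.
by ring.
Qed.

Let D_gt0 i j (s : R) : 0 <= s <= 1 -> 0 < D i j s.
Proof.
move=> /andP[s0 s1]; rewrite DE exprn_gt0// cmod_gt0 subr_eq0.
apply: contraTneq (cmodw i j) => /(congr1 (@cmod R)).
rewrite cmod1 cmodM cmod_rc ger0_norm// => e.
by rewrite -leNgt e ler_piMl ?cmod_ge0.
Qed.

Let chordE d i j : chord d (x i) (x j) = D i j 1 * (1 - (1 - d ^+ 2) * h i j).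
Proof.
have Dn0 : D i j 1 != 0 by rewrite gt_eqF// D_gt0// ler01 lexx.
have -> : D i j 1 * (1 - (1 - d ^+ 2) * h i j) = D i j 1 - (1 - d ^+ 2) *
    ((1 - cmod (x i) ^+ 2) * (1 - cmod (x j) ^+ 2)) by rewrite /h; field.
rewrite /chord /D /a /b /w conjcE cmod_sqr.
have -> : cmod (x i) ^+ 2 * cmod (x j) ^+ 2 =
    (Re (x i) ^+ 2 + complex.Im (x i) ^+ 2) *
    (Re (x j) ^+ 2 + complex.Im (x j) ^+ 2).
  by rewrite -!cmod_sqr.
rewrite !cmod_sqr; case: (x i) => p q; case: (x j) => p' q' /=.
by ring.
Qed.

Let h01 i j : 0 <= h i j <= 1.
Proof.
have D0 : 0 < D i j 1 by rewrite D_gt0// ler01 lexx.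
have cx k : 0 <= 1 - cmod (x k) ^+ 2.
  by rewrite subr_ge0 expr_le1 ?cmod_ge0// ltW.
rewrite /h ?divr_ge0 ?mulr_ge0 ?(ltW D0)//= ler_pdivrMr// mul1r -subr_ge0.
have := chordE 0 i j; rewrite /chord expr0n /= mul0r addr0 subr0 mul1r => e.
have -> : D i j 1 - (1 - cmod (x i) ^+ 2) * (1 - cmod (x j) ^+ 2)
    = D i j 1 * (1 - h i j).
  by rewrite /h; field; rewrite gt_eqF.
by rewrite -e exprn_ge0// cmod_ge0.
Qed.

Let stablew : stable w.
Proof. by move=> A; exact: psd_weight. Qed.

Let stableJw : stable (fun i j => (w i j)^*).
Proof.
move=> A /(psd_conj_weight x); apply: eq_psd => i j.
by rewrite /w rmorphM /= conjCK.
Qed.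

Let stable_scale (s : R) (u : 'I_N -> 'I_N -> CC R) : 0 <= s -> stable u ->
  stable (fun i j => rc s * u i j).
Proof.
move=> s0 su A /su/(psd_scale s0); apply: eq_psd => i j; exact: mulrA.
Qed.

Let scale_lt1 (s : R) (u : CC R) : 0 <= s <= 1 -> cmod u < 1 -> cmod (rc s * u) < 1.
Proof.
move=> /andP[s0 s1] u1; rewrite cmodM cmod_rc ger0_norm//.
by rewrite (le_lt_trans _ u1)// ler_piMl ?cmod_ge0.
Qed.

Let quad_log_far : quad a <= quad (fun i j => - ln (D i j 1) / 2).
Proof.
pose F s i j := - ln (D i j s) / 2 - s * a i j.
pose dF s i j := (a i j - s * b i j) / D i j s - a i j.
have F0 : quad (F 0) = 0.
  rewrite /quad big1// => i _; rewrite big1// => j _.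
  have D0 : D i j 0 = 1 by rewrite /D; ring.
  by rewrite /F D0 ln1 oppr0 !mul0r subr0 mulr0.
have : quad (F 0) <= quad (F 1).
  apply: (quad_derive (dF := dF)) => [i j s s01|s s01].
    exact/is_derive_log_quadratic/D_gt0.
  have [s0 s1] := andP s01.
  apply: (quadE (A := fun i j => rc s * w i j * ((1 - rc s * w i j)^-1 * (w i j * 1)))).
    apply: stable_scale => //; apply: stable_geometric.
    - exact: stable_scale.
    - by move=> i j; exact: scale_lt1.
    - by apply: stablew; exact: psd1.
  move=> i j; rewrite /dF.
  have : D i j s != 0 by rewrite gt_eqF// D_gt0.
  rewrite DE cmod_sqr bE /a; case: (w i j) => u v /= n0.
  by field; move: n0; rewrite !mul0r subr0 addr0 sub0r.
rewrite F0 /quad /F => H.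
rewrite -subr_ge0 (le_trans H)// -sumrB ler_sum// => i _.
by rewrite -sumrB ler_sum// => j _; rewrite mul1r mulrBr.
Qed.

Let quad_log_near (tau : R) : 0 <= tau < 1 ->
  0 <= quad (fun i j => - ln (1 - tau * h i j) / 2).
Proof.
move=> /andP[t0 t1].
have th i j (s : R) : 0 <= s <= 1 -> 0 <= s * tau * h i j < 1.
  move=> /andP[s0 s1]; have /andP[h0 h1] := h01 i j.
  apply/andP; split; first exact: mulr_ge0 (mulr_ge0 s0 t0) h0.
  rewrite (le_lt_trans _ t1)// -mulrA.
  by rewrite (le_trans (ler_piMl (mulr_ge0 t0 h0) s1))// ler_piMr.
pose F s i j := - ln (1 - s * (tau * h i j)) / 2.
pose dF s i j := tau * h i j / (1 - s * (tau * h i j)) / 2.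
have F0 : quad (F 0) = 0.
  rewrite /quad big1// => i _; rewrite big1// => j _.
  by rewrite /F mul0r subr0 ln1 oppr0 mul0r mulr0.
have : quad (F 0) <= quad (F 1).
  apply: (quad_derive (dF := dF)) => [i j s s01|s s01].
    apply: is_derive_log_linear.
    by rewrite mulrA subr_gt0; have /andP[] := th i j s s01.
  have [s0 s1] := andP s01.
  pose H i j : CC R := rc (1 - cmod (x i) ^+ 2) * rc (1 - cmod (x j) ^+ 2)
    * ((1 - w i j)^-1 * (1 - (w i j)^*)^-1).
  have HE i j : H i j = rc (h i j).
    rewrite /H /h rcM rcM rcV -invfM; congr (_ * _^-1).
    have -> : D i j 1 = cmod (1 - w i j) ^+ 2.
      by rewrite DE -[rc 1]/(1 : CC R) mul1r.
    by rewrite rcX -cmod_norm normCK rmorphB /= rmorph1.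
  have stH : stable H.
    have cmodJw i j : cmod (w i j)^* < 1.
      by rewrite conjcE; case: (w i j) (cmodw i j) => u v; rewrite /cmod /= sqrrN.
    move=> A Ap; apply: eq_psd (psd_weight (fun i => rc (1 - cmod (x i) ^+ 2))
      (stable_geometric stablew cmodw (stable_geometric stableJw cmodJw Ap))).
    by move=> i j; rewrite /H -[(rc _)^*]/(conjc _) conjc_real !mulrA.
  have st : 0 <= s * tau by rewrite mulr_ge0.
  apply: (quadE (A := fun i j => rc (tau / 2) *
      ((1 - rc (s * tau) * H i j)^-1 * (H i j * 1)))).
    apply: psd_scale; first by rewrite divr_ge0.
    apply: stable_geometric.
    - exact: stable_scale.
    - move=> i j; rewrite HE -rcM cmod_rc.
      by have /andP[? ?] := th i j s s01; rewrite ger0_norm.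
    - by apply: stH; exact: psd1.
  move=> i j; rewrite mulr1 HE -rcM.
  have -> : 1 - rc (s * tau * h i j) = rc (1 - s * tau * h i j).
    by rewrite -[1 : CC R]/(rc 1) -(rmorphB (real_complex R)).
  rewrite -rcV -!rcM /= /dF.
  have : 1 - s * tau * h i j != 0.
    by rewrite gt_eqF// subr_gt0; have /andP[] := th i j s s01.
  by move=> n0; field; rewrite mulrA.
rewrite F0 => /le_trans; apply; rewrite /quad ler_sum// => i _.
by rewrite ler_sum// => j _; rewrite /F mul1r.
Qed.

Lemma logker_positive d : 0 < d <= 1 ->
  cmod (\sum_i rc (c i) * x i) ^+ 2
    <= \sum_i \sum_j c i * c j * logker d (x i) (x j).
Proof.
move=> /andP[d0 d1].
have tau01 : 0 <= 1 - d ^+ 2 < 1.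
  by rewrite subr_ge0 exprn_ile1 ?(ltW d0)//= ltrBlDr ltrDl exprn_gt0.
have -> : cmod (\sum_i rc (c i) * x i) ^+ 2 = quad a.
  rewrite -[LHS]/(Re (rc (_ ^+ 2))) rcX -cmod_norm normCK mulr_suml raddf_sum.
  apply: eq_bigr => i _; rewrite rmorph_sum mulr_sumr raddf_sum.
  apply: eq_bigr => j _; rewrite /a /w rmorphM /=.
  rewrite mulrACA -[(rc _)^*]/(conjc _) conjc_real -rcM.
  by case: (x i * _) => u v /=; rewrite mul0r subr0.
apply: le_trans quad_log_far _; rewrite -subr_ge0.
apply: le_trans (quad_log_near tau01) _.
rewrite -sumrB ler_sum// => i _; rewrite -sumrB ler_sum// => j _.
rewrite -mulrBr /logker chordE lnM ?posrE.
- by rewrite le_eqVlt; apply/orP/or_introl/eqP; field.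
- by rewrite D_gt0// ler01 lexx.
have := chord_gt0 d0 (x1 i) (x1 j); rewrite chordE pmulr_rgt0//.
by rewrite D_gt0// ler01 lexx.
Qed.

End LogKernel.

(** * Size, continuity and superharmonicity of the kernel *)

Section KernelBounds.
Context {R : realType}.
Implicit Types (x y w : CC R) (d : R).

Lemma logker_le d x y : 0 < d -> cmod x < 1 -> cmod y < 1 -> x != y ->
  logker d x y <= - ln (cmod (x - y)).
Proof.
move=> d0 x1 y1 xy; have xy0 : 0 < cmod (x - y) by rewrite cmod_gt0 subr_eq0.
rewrite /logker mulNr lerN2 ler_pdivlMr// mulr_natr -lnXn//.
rewrite ler_ln ?posrE ?exprn_gt0 ?chord_gt0// lerDl.
by rewrite !mulr_ge0 ?sqr_ge0// ltW// cmod2_lt1.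
Qed.

Lemma logker_ge d x y : 0 < d -> cmod x < 1 -> cmod y < 1 -> x != y ->
  - ln (cmod (x - y)) - d ^+ 2 / (2 * cmod (x - y) ^+ 2) <= logker d x y.
Proof.
move=> d0 x1 y1 xy; have xy0 : 0 < cmod (x - y) by rewrite cmod_gt0 subr_eq0.
set q := cmod (x - y) in xy0 *.
have q2 : 0 < q ^+ 2 by rewrite exprn_gt0.
have ch : chord d x y <= q ^+ 2 * (1 + d ^+ 2 / q ^+ 2).
  rewrite mulrDr mulr1 mulrCA divff ?gt_eqF// mulr1 lerD2l.
  rewrite ler_piMr ?sqr_ge0// mulr_ile1 ?(ltW (cmod2_lt1 _))//.
    by rewrite gerBl exprn_ge0// cmod_ge0.
  by rewrite gerBl exprn_ge0// cmod_ge0.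
have dq : 0 <= d ^+ 2 / q ^+ 2 by rewrite divr_ge0 ?sqr_ge0.
have : ln (chord d x y) <= ln q *+ 2 + d ^+ 2 / q ^+ 2.
  rewrite -lnXn//; apply: (le_trans (y := ln (q ^+ 2 * (1 + d ^+ 2 / q ^+ 2)))).
    rewrite ler_ln ?posrE ?chord_gt0// mulr_gt0// ltr_wpDr//.
  rewrite lnM ?posrE ?ltr_wpDr// lerD2l.
  by apply: le_ln1Dx; rewrite (lt_le_trans _ dq).
rewrite /logker => H; have -> : d ^+ 2 / (2 * q ^+ 2) = (d ^+ 2 / q ^+ 2) / 2.
  by field; rewrite gt_eqF.
by rewrite mulr2n in H; lra.
Qed.

Lemma half_sqr x : cmod x <= 2^-1 -> cmod x ^+ 2 <= 4^-1.
Proof.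
move=> x2; have -> : 4^-1 = 2^-1 ^+ 2 :> R by field.
by rewrite lerXn2r ?nnegrE ?cmod_ge0.
Qed.

Lemma logker_diag_le d x : 0 < d -> cmod x <= 2^-1 ->
  logker d x x <= - ln d + 1.
Proof.
move=> d0 x2; have xq := half_sqr x2.
have x1 : cmod x < 1 by rewrite (le_lt_trans x2)//; lra.
have c0 : 0 < (1 - cmod x ^+ 2) by exact: cmod2_lt1.
rewrite /logker /chord subrr cmod0// expr0n add0r.
rewrite -expr2 -exprMn lnXn ?mulr_gt0// lnM ?posrE//.
have : - ln (1 - cmod x ^+ 2) <= 1.
  have q2 : (1 - cmod x ^+ 2)^-1 <= 2 by rewrite invf_ple ?posrE//; lra.
  rewrite -lnV ?posrE// -[_^-1](subrKC 1) (le_trans (le_ln1Dx _))//; last by lra.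
  by rewrite ltrBrDl subrr invr_gt0.
by rewrite mulr2n; lra.
Qed.

Lemma logker_unif_continuous d e : 0 < d <= 1 -> 0 < e -> exists2 t : R, 0 < t &
  forall x y x' y' : CC R, cmod x <= 2^-1 -> cmod y <= 2^-1 ->
    cmod x' <= 2^-1 -> cmod y' <= 2^-1 ->
    cmod (x - x') < t -> cmod (y - y') < t ->
    logker d x y <= logker d x' y' + e.
Proof.
move=> /andP[d0 d1] e0; exists (e * d ^+ 2 / 16).
  by rewrite divr_gt0// mulr_gt0// exprn_gt0.
set t := _ / 16; move=> x y x' y' hx hy hx' hy' xx' yy'.
have lt1 z : cmod z <= 2^-1 -> cmod z < 1 by move=> /le_lt_trans; apply; lra.
have C0 : 0 < chord d x y by rewrite chord_gt0 ?lt1.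
have C0' : 0 < chord d x' y' by rewrite chord_gt0 ?lt1.
have d2 : 0 < d ^+ 2 by rewrite exprn_gt0.
have Cd : d ^+ 2 / 2 <= chord d x y.
  have := half_sqr hx; have := half_sqr hy; rewrite /chord.
  have := sqr_ge0 (cmod (x - y)); move: d2.
  set p := cmod (x - y) ^+ 2; set u := cmod x ^+ 2; set v := cmod y ^+ 2.
  move=> d2 p0 v4 u4; have uv : 2^-1 <= (1 - u) * (1 - v) by nra.
  by have := ler_wpM2l (ltW d2) uv; lra.
have CC' : chord d x' y' - chord d x y <= 8 * t.
  have b1 : cmod (x' - y') <= cmod (x - y) + 2 * t.
    have := cmod_triangle x x' y'; have := cmod_triangle y x y'.
    by rewrite [cmod (x' - x)]cmodB; lra.
  have b2 : cmod (x - y) <= 1 by rewrite (le_trans (cmodD _ _))// cmodN; lra.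
  have b2' : cmod (x' - y') <= 1 by rewrite (le_trans (cmodD _ _))// cmodN; lra.
  have b3 : cmod x <= cmod x' + t.
    by have := cmodD (x - x') x'; rewrite subrK; lra.
  have b4 : cmod y <= cmod y' + t.
    by have := cmodD (y - y') y'; rewrite subrK; lra.
  have := cmod_ge0 x; have := cmod_ge0 y; have := cmod_ge0 x'.
  have := cmod_ge0 y'; have := cmod_ge0 (x - y); have := cmod_ge0 (x' - y').
  have t0 : 0 <= t by rewrite (le_trans _ (ltW xx'))// cmod_ge0.
  have dd : d ^+ 2 <= 1 by rewrite exprn_ile1// ltW.
  move: b1 b2 b2' b3 b4 hx hy hx' hy'; rewrite /chord.
  set p := cmod (x - y); set p' := cmod (x' - y').
  set u := cmod x; set u' := cmod x'; set v := cmod y; set v' := cmod y'.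
  move=> *.
  have e1 : p' ^+ 2 - p ^+ 2 <= 4 * t by nra.
  have e2 : u ^+ 2 - u' ^+ 2 <= t by nra.
  have e3 : v ^+ 2 - v' ^+ 2 <= t by nra.
  have w1 : 0 <= 1 - v' ^+ 2 <= 1 by nra.
  have w2 : 0 <= 1 - u ^+ 2 <= 1 by nra.
  have e4 : (1 - u' ^+ 2) * (1 - v' ^+ 2) - (1 - u ^+ 2) * (1 - v ^+ 2) <= 2 * t.
    have f1 : (u ^+ 2 - u' ^+ 2) * (1 - v' ^+ 2) <= t by nra.
    have f2 : (1 - u ^+ 2) * (v ^+ 2 - v' ^+ 2) <= t by nra.
    by lra.
  have : d ^+ 2 * ((1 - u' ^+ 2) * (1 - v' ^+ 2)
      - (1 - u ^+ 2) * (1 - v ^+ 2)) <= 2 * t.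
    rewrite (le_trans (ler_wpM2l (ltW d2) e4))// ler_piMl//; lra.
  by lra.
rewrite /logker -lerBlDl -mulrBl opprK addrC -ln_div ?posrE// ler_pdivrMr//.
have -> : chord d x' y' / chord d x y = 1 + (chord d x' y' - chord d x y) / chord d x y.
  by field; rewrite gt_eqF.
apply: le_trans (le_ln1Dx _) _.
  by rewrite -subr_gt0 opprK mulrBl divff ?gt_eqF// addrC subrKC divr_gt0.
rewrite ler_pdivrMr// (le_trans CC')//.
rewrite (le_trans _ (ler_wpM2l _ Cd))//; last by rewrite mulr_ge0// ltW.
have : 0 < e * d ^+ 2 by exact: mulr_gt0.
by rewrite /t; lra.
Qed.

(* The four factors are the values of a strictly subharmonic quadratic at the
   neighbours of a grid point where its value is [Q]. *)
Lemma quartic_mean (Q e A B b : R) : 0 < Q -> 0 < e -> 0 <= b ->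
  A ^+ 2 + B ^+ 2 = e * (Q - b) -> e <= 2 * b ->
  Q ^+ 4 < (Q + e + 2 * A) * (Q + e - 2 * A) * (Q + e + 2 * B) * (Q + e - 2 * B).
Proof.
move=> Q0 e0 b0 AB eb.
have -> : (Q + e + 2 * A) * (Q + e - 2 * A) * (Q + e + 2 * B) * (Q + e - 2 * B)
  = (Q + e) ^+ 4 - 4 * (Q + e) ^+ 2 * (A ^+ 2 + B ^+ 2) + 16 * (A * B) ^+ 2 by ring.
have AB0 := sqr_ge0 (A * B).
have h1 : 0 <= (Q + e) ^+ 2 * e * (2 * b - e) * 2.
  by rewrite mulr_ge0// mulr_ge0 ?subr_ge0// mulr_ge0 ?sqr_ge0// ltW.
have h2 : 0 < 4 * Q * e ^+ 3 + 3 * e ^+ 4.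
  by rewrite addr_gt0// !mulr_gt0// exprn_gt0.
rewrite AB -subr_gt0.
have -> : (Q + e) ^+ 4 - 4 * (Q + e) ^+ 2 * (e * (Q - b)) + 16 * (A * B) ^+ 2 - Q ^+ 4
  = (Q + e) ^+ 2 * e * (2 * b - e) * 2 + (4 * Q * e ^+ 3 + 3 * e ^+ 4)
    + 16 * (A * B) ^+ 2 by ring.
by lra.
Qed.

Lemma logker_superharmonic d (h : R) w y : 0 < d < 1 -> 0 < h ->
  h ^+ 2 <= d ^+ 2 * (1 - d ^+ 2) -> cmod y <= 2^-1 -> cmod w < 1 ->
  cmod (w + rc h) < 1 -> cmod (w - rc h) < 1 ->
  cmod (w + (0 +i* h)%C) < 1 -> cmod (w - (0 +i* h)%C) < 1 ->
  logker d (w + rc h) y + logker d (w - rc h) y + logker d (w + (0 +i* h)%C) y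
    + logker d (w - (0 +i* h)%C) y < 4 * logker d w y.
Proof.
move=> /andP[d0 d1] h0 hd y2 w1 wr wl wu wd.
have y1 : cmod y < 1 by rewrite (le_lt_trans y2)//; lra.
have C0 := chord_gt0 d0 w1 y1.
have Cr := chord_gt0 d0 wr y1. have Cl := chord_gt0 d0 wl y1.
have Cu := chord_gt0 d0 wu y1. have Cd := chord_gt0 d0 wd y1.
suff : chord d w y ^+ 4 < chord d (w + rc h) y * chord d (w - rc h) y
    * chord d (w + (0 +i* h)%C) y * chord d (w - (0 +i* h)%C) y.
  rewrite -ltr_ln ?posrE ?exprn_gt0 ?mulr_gt0// lnXn// !lnM ?posrE ?mulr_gt0//.
  by rewrite -mulr_natl /logker; lra.
have y4 := half_sqr y2.
have d2 : 0 < d ^+ 2 < 1 by rewrite exprn_gt0// expr_lt1// ltW.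
have dy : 0 < d ^+ 2 * (1 - cmod y ^+ 2) < 1 by have := sqr_ge0 (cmod y); nra.
pose s := 1 - cmod y ^+ 2; pose al := 1 - d ^+ 2 * s.
have al0 : 0 < al by rewrite /al /s; lra.
have al1 : al <= 1 by rewrite /al /s; lra.
pose A := h * (al * complex.Re w - complex.Re y).
pose B := h * (al * complex.Im w - complex.Im y).
have ey := cmod_sqr y.
have step (u v : R) : chord d (w + (u +i* v)%C) y = chord d w y + al * (u ^+ 2 + v ^+ 2)
    + 2 * (u * (al * complex.Re w - complex.Re y)
           + v * (al * complex.Im w - complex.Im y)).
  rewrite /chord /al /s !cmod_sqr; case: (w) => p q; case: (y) => p' q' /=.
  by ring.
have e1 : chord d (w + rc h) y = chord d w y + al * h ^+ 2 + 2 * A.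
  by rewrite step /A; ring.
have e2 : chord d (w - rc h) y = chord d w y + al * h ^+ 2 - 2 * A.
  by rewrite -[- rc h]/((- h) +i* (- 0))%C step /A; ring.
have e3 : chord d (w + (0 +i* h)%C) y = chord d w y + al * h ^+ 2 + 2 * B.
  by rewrite step /B; ring.
have e4 : chord d (w - (0 +i* h)%C) y = chord d w y + al * h ^+ 2 - 2 * B.
  by rewrite -[- (0 +i* h)%C]/((- 0) +i* (- h))%C step /B; ring.
rewrite e1 e2 e3 e4.
have dd : 0 <= d ^+ 2 * (1 - d ^+ 2) by rewrite mulr_ge0//; lra.
apply: (@quartic_mean _ _ _ _ (d ^+ 2 * (1 - d ^+ 2) * s ^+ 2 / al)) => //.
- by rewrite mulr_gt0// exprn_gt0.
- by rewrite (divr_ge0 _ (ltW al0))// mulr_ge0 ?sqr_ge0.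
- have -> : al * h ^+ 2 * (chord d w y - d ^+ 2 * (1 - d ^+ 2) * s ^+ 2 / al)
    = h ^+ 2 * (al * chord d w y - d ^+ 2 * (1 - d ^+ 2) * s ^+ 2).
    by field; rewrite gt_eqF.
  rewrite /A /B /chord /al /s !cmod_sqr; case: (w) => p q; case: (y) => p' q' /=.
  by ring.
rewrite mulrA ler_pdivlMr//.
have s2 : 2^-1 <= s ^+ 2 by rewrite /s; have := sqr_ge0 (cmod y); nra.
have h2 := sqr_ge0 h.
have aa : al * al <= 1 by rewrite mulr_ile1// ltW.
have t1 := ler_wpM2l h2 aa.
have t2 := ler_wpM2l dd s2.
by lra.
Qed.

End KernelBounds.

(** * The unbounded component and the minimum principle *)

Section OuterDomain.
Context {R : realType}.
Implicit Types (E : set (CC R)) (w v p : CC R).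

Let line w v (a : R) : one_point_compactification (CC R) := Some (w + rc a * v).

Let continuous_line w v : continuous (line w v).
Proof.
move=> a A Aa; have /nbhs_cmodP[e e0 eA] : nbhs (w + rc a * v) (Some @^-1` A).
  exact: Aa.
apply/nbhs_ballP.
have v0 : 0 < cmod v + 1 by rewrite ltr_wpDl// cmod_ge0.
exists (e / (cmod v + 1)) => /=; first by rewrite divr_gt0.
move=> b; rewrite /ball /= => ab; apply: eA.
have -> : w + rc b * v - (w + rc a * v) = rc (b - a) * v.
  rewrite opprD addrACA subrr add0r -mulrBl; congr (_ * _).
  by rewrite /rc; apply/eqP; rewrite eq_complex /= subrr !eqxx.
rewrite cmodM cmod_rc distrC.
apply: le_lt_trans (_ : `|a - b| * (cmod v + 1) < _).
  by rewrite ler_wpM2l// lerDl.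
by rewrite -ltr_pdivlMr.
Qed.

Let connected_line w v (I : interval R) : connected (line w v @` [set` I]).
Proof.
apply: connected_continuous_connected; last exact/continuous_subspaceT/continuous_line.
by apply/connected_intervalP; exact: interval_is_interval.
Qed.

Lemma Omega_segment E w p : Omega E (Some w) ->
  (forall a : R, 0 <= a <= 1 -> ~ E (w + rc a * (p - w))) -> Omega E (Some p).
Proof.
move=> Ow nE; apply: connected_component_trans Ow _.
exists (line w (p - w) @` `[0, 1]); last first.
  exists 1; first by rewrite /= in_itv /= ler01 lexx.
  by rewrite /line mul1r addrC subrK.
split; last exact: connected_line.
  exists 0; first by rewrite /= in_itv /= ler01 lexx.
  by rewrite /line mul0r addr0.
move=> _ [a + <-] [t Et [tE]]; rewrite /= in_itv /= => a01.
by apply: (nE a a01); rewrite -tE.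
Qed.

Lemma Omega_outside E w (rho : R) : 0 < rho ->
  (forall t, E t -> cmod t < rho) -> rho <= cmod w -> Omega E (Some w).
Proof.
move=> rho0 Erho rhow; have w0 : 0 < cmod w by exact: lt_le_trans rhow.
pose L := line 0 w @` `[1, +oo[.
have Lge t : L (Some t) -> rho <= cmod t.
  move=> [a + [<-]]; rewrite /= in_itv /= andbT add0r => a1.
  rewrite cmodM cmod_rc ger0_norm ?(le_trans _ a1)//.
  by rewrite (le_trans rhow)// ler_peMl// cmod_ge0.
have L1 : L (Some w).
  exists 1; first by rewrite /= in_itv /= lexx.
  by rewrite /line mul1r add0r.
have LN : closure L None.
  move=> U [K [/compact_cmod_bounded[r r0 Kr] _] KU].
  exists (line 0 w (1 + r / cmod w)); split.
    exists (1 + r / cmod w) => //; rewrite /= in_itv /= andbT lerDl.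
    by rewrite divr_ge0 ?cmod_ge0// ltW.
  apply: KU; left; eexists; last reflexivity.
  move=> /Kr; rewrite add0r cmodM cmod_rc ltNge => /negP; apply.
  have rw0 : 0 <= r / cmod w by rewrite divr_ge0 ?cmod_ge0// ltW.
  rewrite ger0_norm ?addr_ge0// mulrDl mul1r divfK ?gt_eqF//.
  by rewrite lerDr cmod_ge0.
exists (closure L); last exact: subset_closure.
split => //; last exact/connected_closure/connected_line.
move=> _ /[swap] -[t Et <-] Lt.
have Ut : nbhs t [set u | cmod (u - 0) < rho].
  by apply: open_nbhs_nbhs; split; [exact: open_cmod_ball|rewrite /= subr0 Erho].
have [_ [/[swap] -[u ut <-] /Lge]] :=
  Lt _ (@one_point_compactification_some_nbhs _ t _ Ut).
by rewrite leNgt => /negP; apply; move: ut; rewrite /= subr0.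
Qed.

End OuterDomain.

Section DiscreteMinimumPrinciple.
Context {R : realType}.

Lemma grid_minimum (G : int -> int -> R) (bad : int -> int -> Prop) (K : nat) :
  (forall a b, bad a b ->
    - K%:Z <= a <= K%:Z /\ - K%:Z <= b <= K%:Z) -> bad 0 0 ->
  (forall a b, bad a b ->
    G (a + 1) b + G (a - 1) b + G a (b + 1) + G a (b - 1) < 4 * G a b) ->
  exists p q : int * int, [/\ bad p.1 p.2, ~ bad q.1 q.2,
    q \in [:: (p.1 + 1, p.2); (p.1 - 1, p.2); (p.1, p.2 + 1); (p.1, p.2 - 1)] &
    G q.1 q.2 <= G 0 0].
Proof.
move=> badK bad0 meanG.
pose T : finType := ('I_(K.*2.+1) * 'I_(K.*2.+1))%type.
pose f (i : 'I_(K.*2.+1)) : int := i%:Z - K%:Z.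
have fP a : - K%:Z <= a <= K%:Z -> exists i, f i = a.
  move=> aK; have lt : (`|(a + K%:Z)%R| < K.*2.+1)%N by lia.
  by exists (Ordinal lt); rewrite /f /= gez0_abs ?addrK//; lia.
have [i0 fi0] : exists i, f i = 0 by apply: fP; lia.
pose P (t : T) := `[< bad (f t.1) (f t.2) >].
have P0 : P (i0, i0) by apply/asboolP; rewrite /= fi0.
have [t /asboolP Pt tmin] := arg_minP (fun t : T => G (f t.1) (f t.2)) P0.
have Gmin a b : bad a b -> G (f t.1) (f t.2) <= G a b.
  move=> /[dup] /badK[/fP[i <-] /fP[j <-]] ij.
  by apply: (tmin (i, j)); apply/asboolP.
apply: contrapT => none.
have nb q : q \in [:: (f t.1 + 1, f t.2); (f t.1 - 1, f t.2);
    (f t.1, f t.2 + 1); (f t.1, f t.2 - 1)] ->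
    G (f t.1) (f t.2) <= G q.1 q.2.
  move=> qin; have [/Gmin//|nbq] := pselect (bad q.1 q.2).
  rewrite leNgt; apply/negP => lt; apply: none.
  exists (f t.1, f t.2), q; split => //.
  by rewrite (le_trans (ltW lt))// Gmin.
have n1 := nb (f t.1 + 1, f t.2); have n2 := nb (f t.1 - 1, f t.2).
have n3 := nb (f t.1, f t.2 + 1); have n4 := nb (f t.1, f t.2 - 1).
move: n1 n2 n3 n4; rewrite !inE !eqxx ?orbT => n1 n2 n3 n4.
have := n1 isT; have := n2 isT; have := n3 isT; have := n4 isT.
by move=> /=; have := meanG _ _ Pt; lra.
Qed.

End DiscreteMinimumPrinciple.

Section DistanceToSet.
Context {R : realType} (E : set (CC R)).
Implicit Types w p t : CC R.

Lemma dist_to_le w t : E t -> dist_to E w <= cmod (w - t).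
Proof.
move=> Et; apply: ge_inf; last by exists t.
by exists 0 => _ [u _ <-]; exact: cmod_ge0.
Qed.

Lemma dist_to_ge w (r : R) : E !=set0 -> (forall t, E t -> r <= cmod (w - t)) ->
  r <= dist_to E w.
Proof.
move=> [t0 Et0] rE; apply: lb_le_inf; first by exists (cmod (w - t0)), t0.
by move=> _ [t Et <-]; exact: rE.
Qed.

Lemma dist_to_lip w p : E !=set0 -> dist_to E p <= dist_to E w + cmod (p - w).
Proof.
move=> E0; rewrite -lerBlDr; apply: dist_to_ge => // t Et.
rewrite lerBlDr (le_trans (dist_to_le p Et))//.
by rewrite (le_trans (cmod_triangle w p t))// addrC.
Qed.

End DistanceToSet.

Section PotentialLowerBound.
Context {R : realType}.
Variables (E : set (CC R)) (rho L : R).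
Hypotheses (rho0 : 0 < rho) (Erho : forall t, E t -> cmod t < rho).
Hypothesis rhoL : 2 * (rho + 2) <= L.
Definition rescale (l : R) (z : CC R) : CC R := rc l^-1 * z.

Lemma rescaleB l z w : rescale l (z - w) = rescale l z - rescale l w.
Proof. exact: mulrBr. Qed.

Lemma cmod_rescale l z : 0 < l -> cmod (rescale l z) = cmod z / l.
Proof. by move=> l0; rewrite cmodM cmod_rc ger0_norm ?invr_ge0 1?ltW// mulrC. Qed.

Let L0 : 0 < L. Proof. have := rho0; have := rhoL; lra. Qed.

Lemma rescale_half z : cmod z <= rho + 2 -> cmod (rescale L z) <= 2^-1.
Proof.
move=> zr; rewrite cmod_rescale// ler_pdivrMr//; have := rhoL; lra.
Qed.

Variables (N : nat) (b : 'I_N -> CC R) (m : 'I_N -> R) (d : R).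
Hypotheses (Eb : forall i, E (b i)) (m0 : forall i, 0 <= m i).
Hypothesis m1 : \sum_i m i = 1.
Hypothesis d01 : 0 < d < 1.

Let V w := \sum_i m i * logker d (rescale L w) (rescale L (b i)).

Lemma potential_mean_lt w (h : R) : cmod w <= rho + 1 -> 0 < h <= 1 ->
  (h / L) ^+ 2 <= d ^+ 2 * (1 - d ^+ 2) ->
  V (w + rc h) + V (w - rc h) + V (w + (0 +i* h)%C) + V (w - (0 +i* h)%C) < 4 * V w.
Proof.
move=> wr /andP[h0 h1] hd.
have half z : cmod z <= rho + 2 -> cmod (rescale L z) < 1.
  by move=> /rescale_half /le_lt_trans; apply; lra.
have ch : cmod (0 +i* h)%C = h.
  by rewrite cmodi ger0_norm// ltW.
have cr : cmod (rc h) = h by rewrite cmod_rc ger0_norm// ltW.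
have near v : cmod v = h -> cmod (w + v) <= rho + 2.
  by move=> vh; rewrite (le_trans (cmodD _ _))// vh; lra.
have term i : logker d (rescale L (w + rc h)) (rescale L (b i))
    + logker d (rescale L (w - rc h)) (rescale L (b i))
    + logker d (rescale L (w + (0 +i* h)%C)) (rescale L (b i))
    + logker d (rescale L (w - (0 +i* h)%C)) (rescale L (b i))
    < 4 * logker d (rescale L w) (rescale L (b i)).
  have e1 : rescale L (rc h) = rc (h / L) by rewrite /rescale -rcM mulrC.
  have e2 : rescale L (0 +i* h)%C = (0 +i* (h / L))%C.
    apply/eqP; rewrite /rescale eq_complex /= !mul0r mulr0 subrr addr0 mulrC.
    by rewrite !eqxx.
  have rD z v : rescale L (z + v) = rescale L z + rescale L v by exact: mulrDr.
  have n1 := half _ (near _ cr); have n3 := half _ (near _ ch).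
  have n2 : cmod (rescale L (w - rc h)) < 1 by apply/half/near; rewrite cmodN.
  have n4 : cmod (rescale L (w - (0 +i* h)%C)) < 1 by apply/half/near; rewrite cmodN.
  rewrite !rescaleB !rD e1 e2 in n1 n2 n3 n4 *.
  apply: logker_superharmonic => //.
  - by rewrite divr_gt0.
  - by apply: rescale_half; have := Erho (Eb i); lra.
  - by apply: half; lra.
rewrite /V mulr_sumr -!big_split /= lt_neqAle; apply/andP; split; last first.
  apply: ler_sum => i _; rewrite -!mulrDr mulrCA ler_wpM2l//.
  exact: ltW.
apply/negP => /eqP eqs.
have z0 : \sum_i m i * (4 * logker d (rescale L w) (rescale L (b i))
    - (logker d (rescale L (w + rc h)) (rescale L (b i))
    + logker d (rescale L (w - rc h)) (rescale L (b i))
    + logker d (rescale L (w + (0 +i* h)%C)) (rescale L (b i))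
    + logker d (rescale L (w - (0 +i* h)%C)) (rescale L (b i)))) = 0.
  rewrite -[RHS](subrr (\sum_i 4 * (m i * logker d (rescale L w) (rescale L (b i))))).
  rewrite -{2}eqs -sumrB; apply: eq_bigr => i _; ring.
have mz i : m i = 0.
  have ge0 j : true -> 0 <= m j * (4 * logker d (rescale L w) (rescale L (b j))
    - (logker d (rescale L (w + rc h)) (rescale L (b j))
    + logker d (rescale L (w - rc h)) (rescale L (b j))
    + logker d (rescale L (w + (0 +i* h)%C)) (rescale L (b j))
    + logker d (rescale L (w - (0 +i* h)%C)) (rescale L (b j)))).
    by move=> _; rewrite mulr_ge0// subr_ge0 ltW.
  have /eqP := psumr_eq0P ge0 z0 (isT : true) (i := i).
  by rewrite mulf_eq0 subr_eq0 orbC gt_eqF//= => /eqP.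
by move: m1; rewrite big1 => [/esym/eqP|i _]; rewrite ?oner_eq0.
Qed.

Let outside_good p (r : R) : 0 < r <= 1 -> E !=set0 -> rho + 1 < cmod p ->
  Omega E (Some p) /\ r <= dist_to E p.
Proof.
move=> /andP[r0 r1] E0 pr; split.
  by apply: (Omega_outside rho0 Erho); have := rho0; lra.
apply: dist_to_ge => // t /Erho tr.
by have := cmodD (p - t) t; rewrite subrK; lra.
Qed.

(* The discretised potential is superharmonic, so on a fine grid its minimum over
   the points that are not in [Omega E] at distance at least [r] from [E] is
   beaten at a neighbour of that set. *)
Lemma potential_lower (r T : R) : 0 < r <= 1 ->
  (forall w, Omega E (Some w) -> r <= dist_to E w <= 2 * r ->
    cmod w <= rho + 2 -> T <= V w) ->
  forall w, E w -> T <= V w.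
Proof.
move=> /[dup] r01 /andP[r0 r1] VT w0 Ew0.
have [d0 d1] := andP d01.
have E0 : E !=set0 by exists w0.
pose k := d ^+ 2 * (1 - d ^+ 2); pose h := r * k.
have d2 : 0 < d ^+ 2 < 1 by rewrite exprn_gt0// expr_lt1// ltW.
have k01 : 0 < k < 1 by rewrite /k; nra.
have [k0 k1] := andP k01.
have h0 : 0 < h by rewrite mulr_gt0.
have hr : h <= r by rewrite ler_piMr// ltW.
have hk : (h / L) ^+ 2 <= k.
  have hL : h / L <= k.
    rewrite ler_pdivrMr// (le_trans (y := k))//; first by rewrite ler_piMl// ltW.
    by rewrite ler_peMr// ?ltW//; have := rhoL; have := rho0; lra.
  have hL0 : 0 <= h / L by rewrite divr_ge0 ?ltW.
  by nra.
pose pt (i j : int) : CC R := w0 + ((i%:~R * h) +i* (j%:~R * h))%C.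
pose bad (i j : int) := ~ (Omega E (Some (pt i j)) /\ r <= dist_to E (pt i j)).
have pt0 : pt 0 0 = w0.
  by rewrite /pt !mul0r; exact: addr0.
have ptr i j : pt (i + 1) j = pt i j + rc h.
  rewrite /pt -addrA; congr (_ + _); apply/eqP; rewrite eq_complex /=.
  by rewrite intrD mulrDl mul1r addr0 !eqxx.
have ptl i j : pt (i - 1) j = pt i j - rc h.
  by rewrite -{2}(subrK 1 i) ptr addrK.
have ptu i j : pt i (j + 1) = pt i j + (0 +i* h)%C.
  rewrite /pt -addrA; congr (_ + _); apply/eqP; rewrite eq_complex /=.
  by rewrite intrD mulrDl mul1r addr0 !eqxx.
have ptd i j : pt i (j - 1) = pt i j - (0 +i* h)%C.
  by rewrite -{2}(subrK 1 j) ptu addrK.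
have badle i j : bad i j -> cmod (pt i j) <= rho + 1.
  move=> nb; rewrite leNgt; apply/negP => lt; apply: nb.
  exact: outside_good.
pose K := Num.bound ((2 * rho + 1) / h).
have Kh : 2 * rho + 1 < K%:R * h.
  rewrite -ltr_pdivrMr//; apply: archi_boundP.
  by rewrite divr_ge0 ?(ltW h0)//; have := rho0; lra.
have intK (a : int) : `|a%:~R * h| <= 2 * rho + 1 -> - K%:Z <= a <= K%:Z.
  rewrite normrM (gtr0_norm h0) => ah.
  have : `|a%:~R| < K%:R :> R by rewrite -(ltr_pM2r h0); lra.
  rewrite -intr_norm -[K%:R]/(K%:Z%:~R) ltr_int => aK.
  by rewrite -ler_norml ltW.
have badK i j : bad i j -> - K%:Z <= i <= K%:Z /\ - K%:Z <= j <= K%:Z.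
  move=> /badle pr.
  have ptw : cmod (pt i j - w0) <= 2 * rho + 1.
    by rewrite (le_trans (cmodD _ _))// cmodN; have := Erho Ew0; lra.
  rewrite /pt addrC addKr in ptw.
  split; apply: intK; apply: le_trans ptw; [exact: (normr_Re_le (_ +i* _)%C)|].
  exact: (normr_Im_le (_ +i* _)%C).
have bad0 : bad 0 0.
  rewrite /bad pt0 => -[_]; have := dist_to_le w0 Ew0.
  by rewrite subrr cmod0//; lra.
have meanV i j : bad i j ->
    V (pt (i + 1) j) + V (pt (i - 1) j) + V (pt i (j + 1)) + V (pt i (j - 1))
    < 4 * V (pt i j).
  move=> /badle pr; rewrite ptr ptl ptu ptd; apply: potential_mean_lt => //.
  by rewrite h0 (le_trans hr).
have [[a a'] [q [badp /= /contrapT[Oq rq] adj]]] :=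
  grid_minimum (G := fun i j => V (pt i j)) badK bad0 meanV.
rewrite pt0 => /(le_trans _); apply.
set p' := pt q.1 q.2 in Oq rq *; set p := pt a a' in badp.
have pp' : cmod (p' - p) = h.
  have crh : cmod (rc h) = h by rewrite cmod_rc gtr0_norm.
  have cih : cmod (0 +i* h)%C = h.
    by rewrite cmodi gtr0_norm.
  move: adj; rewrite !inE /p' /p => /or4P[] /eqP -> /=.
  - by rewrite ptr addrC addKr.
  - by rewrite ptl addrC addKr cmodN.
  - by rewrite ptu addrC addKr.
  - by rewrite ptd addrC addKr cmodN.
apply: VT => //; last first.
  have := cmodD (p' - p) p; rewrite subrK pp'; have := badle _ _ badp.
  by rewrite -/p; lra.
rewrite rq /=; have [Op|nOp] := pselect (Omega E (Some p)).
  have dp : dist_to E p < r.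
    by rewrite ltNge; apply/negP => rp; exact: badp.
  by have := dist_to_lip p p' E0; rewrite pp'; lra.
have [t [c01 Et]] : exists t : R, 0 <= t <= 1 /\ E (p' + rc t * (p - p')).
  apply: contrapT => no; apply: nOp; apply: (Omega_segment Oq) => t t01 Et.
  by apply: no; exists t.
rewrite (le_trans (dist_to_le p' Et))// opprD addrA subrr add0r cmodN cmodM.
rewrite cmod_rc cmodB pp'; have /andP[t0 t1] := c01; rewrite ger0_norm//.
by rewrite (le_trans (ler_piMl (ltW h0) t1))//; lra.
Qed.

End PotentialLowerBound.

(** * Integrals of functions that need not be measurable *)

Section MonotoneLowerIntegral.
Local Open Scope ereal_scope.
Context d (T : measurableType d) (R : realType).
Variables (mu : {measure set T -> \bar R}) (D : set T).
Hypotheses (mD : measurable D) (muD : mu (~` D) = 0).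
Import HBNNSimple.

(* No measurability is needed: the integral of a nonnegative function is a
   supremum over the simple functions below it. *)
Lemma ge0_le_integral_conull (f g : T -> \bar R) :
  (forall x, 0 <= f x) -> (forall x, 0 <= g x) ->
  (forall x, D x -> f x <= g x) -> \int[mu]_x f x <= \int[mu]_x g x.
Proof.
move=> f0 g0 fg; rewrite ge0_integralTE// (ge0_integralTE _ g0).
apply: ge_ereal_sup => _ [h /= hf <-].
have -> : sintegral mu h = sintegral mu (proj_nnsfun h mD).
  transitivity (\int[mu]_x (h x)%:E).
    by rewrite integral_nnsfun// patch_setT.
  rewrite (@ge0_negligible_integral _ _ _ _ _ (~` D))//.
  - rewrite setTD setCK integral_nnsfun//; apply: eq_sintegral => x /=.
    by rewrite /proj_nnsfun /= patch_indic.
  - exact: measurableC.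
  - by apply/measurable_EFinP; exact: measurable_funTS.
  - by move=> x _; rewrite lee_fin fun_ge0.
apply: ereal_sup_ubound; exists (proj_nnsfun h mD) => // x /=.
rewrite mindicE; have [xD|] := boolP (x \in D); last by rewrite mulr0.
by rewrite mulr1 (le_trans (hf x))// fg//; rewrite inE in xD.
Qed.

Lemma le_integral_conull (f g : T -> \bar R) :
  (forall x, D x -> f x <= g x) -> \int[mu]_x f x <= \int[mu]_x g x.
Proof.
move=> fg; rewrite (integralE _ _ f) (integralE _ _ g); apply: leeB.
- apply: ge0_le_integral_conull => // x Dx.
  by rewrite !funeposE; exact: (le_max2 (fg _ Dx) (lexx _)).
- apply: ge0_le_integral_conull => // x Dx.
  by rewrite !funenegE; by apply: le_max2 => //; rewrite leeN2; exact: fg.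
Qed.

End MonotoneLowerIntegral.

Section StepFunctions.
Context d (T : measurableType d) (R : realType) (mu : probability T R).
Variables (D : set T) (N : nat) (B : 'I_N -> set T).
Hypotheses (mD : measurable D) (muD : mu (~` D) = 0%E).
Hypothesis mB : forall i, measurable (B i).
Hypothesis tB : forall i j x, B i x -> B j x -> i = j.
Hypothesis coverB : forall x, D x -> exists i, B i x.

Let stepE (v : 'I_N -> R) i x : B i x -> \sum_j v j * \1_(B j) x = v i.
Proof.
move=> Bix; rewrite (bigD1 i)//= big1 ?addr0.
  by rewrite indicE mem_set// mulr1.
move=> j ji; rewrite indicE memNset ?mulr0// => Bjx.
by move/eqP: ji; apply; exact: tB Bjx Bix.
Qed.

Let muB_fin i : mu (B i) \is a fin_num.
Proof. exact: fin_num_measure. Qed.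

Lemma integral_step (v : 'I_N -> R) :
  (\int[mu]_x (\sum_i v i * \1_(B i) x)%:E = (\sum_i v i * fine (mu (B i)))%:E)%E.
Proof.
have Bint i : mu.-integrable setT (EFin \o \1_(B i)).
  exact: integrable_indic.
under eq_integral do rewrite -sumEFin.
rewrite integral_sum//; last first.
  by move=> i; exact: (integrableZl measurableT (v i) (Bint i)).
rewrite -sumEFin; apply: eq_bigr => i _.
under eq_integral do rewrite EFinM.
by rewrite (integralZl measurableT (Bint i)) integral_indic// setIT EFinM fineK.
Qed.

Lemma step_le_integral (v : 'I_N -> R) (f : T -> \bar R) :
  (forall i x, D x -> B i x -> (v i)%:E <= f x)%E ->
  ((\sum_i v i * fine (mu (B i)))%:E <= \int[mu]_x f x)%E.
Proof.
move=> vf; rewrite -integral_step; apply: (le_integral_conull mD muD) => x Dx.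
by have [i Bix] := coverB Dx; rewrite (stepE v Bix); exact: vf.
Qed.

Lemma integral_le_step (v : 'I_N -> R) (f : T -> \bar R) :
  (forall i x, D x -> B i x -> f x <= (v i)%:E)%E ->
  (\int[mu]_x f x <= (\sum_i v i * fine (mu (B i)))%:E)%E.
Proof.
move=> vf; rewrite -integral_step; apply: (le_integral_conull mD muD) => x Dx.
by have [i Bix] := coverB Dx; rewrite (stepE v Bix); exact: vf.
Qed.

Lemma sum_step_measure : \sum_i fine (mu (B i)) = 1.
Proof.
have H1 : (\int[mu]_x (1%:E : \bar R) = 1)%E.
  by rewrite (integral_cst mu measurableT) mul1e; exact: probability_setT.
apply/eqP; rewrite eq_le -!lee_fin -H1.
have -> : \sum_i fine (mu (B i)) = \sum_i 1 * fine (mu (B i)).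
  by apply: eq_bigr => i _; rewrite mul1r.
by rewrite step_le_integral ?integral_le_step.
Qed.

End StepFunctions.

(** * The discriminant *)

Section Resultant.
Variables (F : fieldType) (m : nat).
Local Notation n := m.+1.
Variables (P : {poly int}) (z : 'I_n -> F).
Hypothesis sizeP : size P = n.+1.
Hypothesis rootz : forall k, root (map_poly intr P) (z k).
Hypothesis z_inj : injective z.

Let Q : {poly F} := map_poly intr P.
Let low (p : {poly int}) q : 'M[int]_(q, n) := \matrix_(i, k) (p * 'X^i)`_k.
Let high (p : {poly int}) q : 'M[int]_(q, m) :=
  \matrix_(i, j) (p * 'X^i)`_(n + j).
Let Vlow : 'M[F]_n := Vandermonde n (\row_k z k).
Let Vhigh : 'M[F]_(m, n) := \matrix_(j, k) z k ^+ (n + j).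

Let eval (p : {poly int}) q : (forall i : 'I_q, size (p * 'X^i)%R <= n + m)%N ->
  map_mx intr (high p q) *m Vhigh + map_mx intr (low p q) *m Vlow
  = \matrix_(i, k) ((map_poly intr p).[z k] * z k ^+ i).
Proof.
move=> sp; apply/matrixP => i k; rewrite !mxE.
have -> : (map_poly intr p).[z k] * z k ^+ i
    = (map_poly intr (p * 'X^i) : {poly F}).[z k].
  by rewrite rmorphM /= map_polyXn hornerM hornerXn.
rewrite (@horner_coef_wide _ (n + m)); last first.
  by rewrite (leq_trans (size_poly _ _))// sp.
rewrite big_split_ord /= addrC; congr (_ + _); apply: eq_bigr => j _.
  by rewrite !mxE coef_map.
by rewrite !mxE coef_map.
Qed.

(* The resultant of [P] and its derivative is an integer; multiplying Sylvester's
   matrix by powers of the roots evaluates it. *)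
Lemma resultant_deriv_roots : exists d : int,
  d%:~R = (lead_coef P)%:~R ^+ m * \prod_k Q^`().[z k].
Proof.
pose S := block_mx (high P m) (low P m) (high P^`() n) (low P^`() n).
pose W : 'M[F]_(m + n) := block_mx 1%:M Vhigh 0 Vlow.
exists (\det S).
have detV : \det Vlow != 0.
  rewrite det_Vandermonde; apply/prodf_neq0 => i _; apply/prodf_neq0 => j ij.
  by rewrite !mxE subr_eq0 (inj_eq z_inj); apply: contraTneq ij => ->; rewrite ltnn.
have sP' : (size P^`() <= n)%N.
  by rewrite -ltnS -sizeP lt_size_deriv// -size_poly_eq0 sizeP.
have SW : map_mx intr S *m W = block_mx (map_mx intr (high P m)) 0
    (map_mx intr (high P^`() n)) (Vlow *m diag_mx (\row_k Q^`().[z k])).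
  rewrite map_block_mx mulmx_block !mulmx1 !mulmx0 !addr0 !eval.
  - congr block_mx.
      by apply/matrixP => i k; rewrite !mxE (rootP (rootz k)) mul0r.
    apply/matrixP => i k; rewrite mul_mx_diag !mxE mulrC.
    by rewrite /Q deriv_map.
  - move=> i; rewrite (leq_trans (size_polyMleq _ _))// size_polyXn.
    by rewrite addnS /= leq_add// -ltnS.
  - move=> i; rewrite (leq_trans (size_polyMleq _ _))// size_polyXn sizeP.
    by rewrite addnS /= addSnnS leq_add.
apply: (mulIf detV).
have := congr1 determinant SW.
rewrite det_mulmx det_map_mx det_ublock det1 mul1r => ->.
rewrite det_lblock det_mulmx det_diag mulrCA mulrC; congr (_ * _ * _); last first.
  by apply: eq_bigr => k _; rewrite mxE.
rewrite det_map_mx det_trig; last first.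
  apply/is_trig_mxP => i j ij; rewrite mxE coefMXn ltnNge.
  rewrite (leq_trans (ltnW (ltn_ord i)))/=; last by rewrite addSn ltnW// ltnS leq_addr.
  by apply: nth_default; rewrite sizeP; lia.
rewrite rmorph_prod /= (eq_bigr (fun _ => (lead_coef P)%:~R)).
  by rewrite prodr_const card_ord.
move=> i _; rewrite mxE coefMXn ltnNge leq_addl /= addnK /lead_coef sizeP.
by [].
Qed.

End Resultant.

Section Discriminant.
Context {R : realType}.

Lemma ln_prod (I : Type) (r : seq I) (p : pred I) (f : I -> R) :
  (forall i, p i -> 0 < f i) ->
  ln (\prod_(i <- r | p i) f i) = \sum_(i <- r | p i) ln (f i).
Proof.
move=> f0; suff [] : 0 < \prod_(i <- r | p i) f i /\
    ln (\prod_(i <- r | p i) f i) = \sum_(i <- r | p i) ln (f i) by [].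
elim/big_rec2 : _ => [|i x y pi [y0 IH]]; first by rewrite ln1.
by rewrite mulr_gt0 ?f0// lnM ?posrE ?f0// IH.
Qed.

Lemma cmod_prod (I : Type) (r : seq I) (p : pred I) (f : I -> CC R) :
  cmod (\prod_(i <- r | p i) f i) = \prod_(i <- r | p i) cmod (f i).
Proof.
elim/big_rec2 : _ => [|i y x _ <-]; last by rewrite cmodM.
by rewrite cmod1.
Qed.

Lemma cmod_int (d : int) : cmod (d%:~R : CC R) = `|d|%:~R.
Proof.
have -> : d%:~R = rc d%:~R :> CC R by rewrite -(rmorph_int (real_complex R) d).
by rewrite cmod_rc intr_norm.
Qed.

Variables (n : nat) (E : set (CC R)) (M : R) (P : {poly int}).
Variable z : 'I_n.+1 -> CC R.
Hypothesis PE : simple_int_poly n.+1 E M P.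
Hypothesis Pz : polyC_of_int R P =
  (lead_coef P)%:~R *: \prod_(k < n.+1) ('X - (z k)%:P).

Let leadP0 : (lead_coef P)%:~R != 0 :> CC R.
Proof.
have [_ _ lP _] := PE; rewrite -cmod_eq0 cmod_int gt_eqF//.
by rewrite -[0]/(0%:~R) ltr_int.
Qed.

Lemma simple_int_poly_root k : root (polyC_of_int R P) (z k).
Proof.
by rewrite Pz rootZ// (bigD1 k)//= rootM root_XsubC eqxx.
Qed.

Lemma simple_int_poly_inj : injective z.
Proof.
move=> i j zij; have [_ /(_ _ (simple_int_poly_root i))[_ +] _ _] := PE.
rewrite Pz -mul_polyC mupMr ?rootC//.
rewrite -(big_map z xpredT (fun y => 'X - y%:P)) mu_prod_XsubC => c1.
apply/eqP; apply: contraTT (isT : true) => ij; exfalso.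
move: c1; rewrite count_map /index_enum -enumT => c1.
have : (size [:: i; j] <= size [seq k <- enum 'I_n.+1 | z k == z i])%N.
  apply: uniq_leq_size; first by rewrite /= inE ij.
  by move=> k; rewrite !inE mem_filter mem_enum andbT => /orP[]/eqP ->; rewrite ?zij.
by rewrite size_filter /= (_ : count _ _ = 1%N).
Qed.

Lemma discriminant_bound :
  0 <= (2 * n + 1)%:R * ln (`|lead_coef P|%:~R : R) +
       \sum_(k < n.+1) \sum_(j < n.+1 | j != k) ln (cmod (z k - z j)).
Proof.
have [sP _ lP _] := PE.
set A := `|lead_coef P|%:~R : R.
have A0 : 0 < A by rewrite -[0]/(0%:~R) ltr_int.
have dz k : (polyC_of_int R P)^`().[z k]
    = (lead_coef P)%:~R * \prod_(j < n.+1 | j != k) (z k - z j).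
  rewrite Pz derivZ hornerZ (bigD1 k)//= derivM derivXsubC mul1r.
  rewrite hornerD hornerM hornerXsubC subrr mul0r addr0; congr (_ * _).
  by rewrite horner_prod; apply: eq_bigr => j _; rewrite hornerXsubC.
have z0 k j : j != k -> 0 < cmod (z k - z j).
  move=> jk; rewrite cmod_gt0 subr_eq0; apply: contraNneq jk.
  by move=> /simple_int_poly_inj ->.
have [d dE] := resultant_deriv_roots sP simple_int_poly_root simple_int_poly_inj.
have := congr1 (@cmod R) dE.
rewrite cmod_int cmodM cmod_prod.
have -> : (lead_coef P)%:~R ^+ n = ((lead_coef P) ^+ n)%:~R :> CC R.
  by rewrite rmorphXn.
rewrite cmod_int normrX rmorphXn /= -/A.
under eq_bigr do rewrite dz cmodM cmod_int cmod_prod -/A.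
rewrite big_split /= prodr_const card_ord mulrA -exprD => dA.
have p0 : 0 < \prod_(k < n.+1) \prod_(j < n.+1 | j != k) cmod (z k - z j).
  by apply: prodr_gt0 => k _; apply: prodr_gt0 => j; exact: z0.
have : 1 <= (`|d|%:~R : R).
  rewrite -[1]/(1%:~R) ler_int -gtz0_ge1 -(ltr_int R) dA.
  by rewrite mulr_gt0// exprn_gt0.
rewrite dA => /ln_ge0.
rewrite lnM ?posrE ?exprn_gt0// lnXn// ln_prod; last first.
  by move=> k _; apply: prodr_gt0 => j; exact: z0.
rewrite addnS addnn -mul2n addn1 mulr_natl.
rewrite [in X in _ -> X](eq_bigr (fun k =>
  ln (\prod_(j < n.+1 | j != k) cmod (z k - z j))))// => k _.
by rewrite ln_prod// => j; exact: z0.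
Qed.

End Discriminant.

(** * Energy estimates *)

Section Discretization.
Context {R : realType}.
Variables (E : set (CC R)) (rho L : R) (mu : probability (borelC R) R).
Hypotheses (cE : compact E) (rho0 : 0 < rho).
Hypothesis Erho : forall t, E t -> cmod t < rho.
Hypothesis rhoL : 2 * (rho + 2) <= L.
Hypothesis muE : prob_on E mu.

Lemma discretization (d eta : R) : 0 < d <= 1 -> 0 < eta ->
  exists (N : nat) (b : 'I_N -> CC R) (m : 'I_N -> R),
  [/\ forall i, E (b i), forall i, 0 <= m i, \sum_i m i = 1,
      ((\sum_i \sum_j m i * m j *
          logker d (rescale L (b i)) (rescale L (b j)) - (ln L + eta))%:E
        <= energy mu)%E
    & forall (w : CC R) (tau : R), cmod w <= rho + 2 ->
      (forall t, E t -> 0 < cmod (w - t) /\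
        - ln (cmod (w - t)) <= logker d (rescale L w) (rescale L t) - ln L + tau) ->
      (log_potential mu w <=
        (\sum_i m i * logker d (rescale L w) (rescale L (b i))
          - ln L + tau + eta)%:E)%E].
Proof.
move=> d01 eta0; have [d0 _] := andP d01.
have L0 : 0 < L by have := rho0; have := rhoL; lra.
have [th th0 uc] := logker_unif_continuous d01 eta0.
have [N [b [B [Eb mB tB cB bB]]]] := fine_partition cE (mulr_gt0 th0 L0).
have mE : measurable (E : set (borelC R)) := compact_measurableC cE.
have half w : cmod w <= rho + 2 -> cmod (rescale L w) <= 2^-1.
  exact: (rescale_half rho0 rhoL).
have halfE t : E t -> cmod (rescale L t) <= 2^-1.
  by move=> /Erho tr; apply: half; have := rho0; lra.
have lt1 (w : CC R) : cmod w <= 2^-1 -> cmod w < 1 by move=> /le_lt_trans; apply; lra.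
have close i t : B i t -> cmod (rescale L t - rescale L (b i)) < th.
  by move=> /bB bt; rewrite -rescaleB cmod_rescale// ltr_pdivrMr.
pose m i := fine (mu (B i)).
have m1 : \sum_i m i = 1 := sum_step_measure mE muE mB tB cB.
have m0 i : 0 <= m i by exact: fine_ge0.
exists N, b, m; split => //.
- pose v i := \sum_j
    (logker d (rescale L (b i)) (rescale L (b j)) - (ln L + eta)) * m j.
  have -> : \sum_i \sum_j m i * m j *
      logker d (rescale L (b i)) (rescale L (b j)) - (ln L + eta) = \sum_i v i * m i.
    have vE i : v i = \sum_j logker d (rescale L (b i)) (rescale L (b j)) * m j
        - (ln L + eta).
      rewrite /v; under eq_bigr do rewrite mulrBl.
      by rewrite sumrB -mulr_sumr m1 mulr1.
    under [RHS]eq_bigr do rewrite vE mulrBl.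
    rewrite sumrB -mulr_sumr m1 mulr1; congr (_ - _).
    apply: eq_bigr => i _; rewrite mulr_suml; apply: eq_bigr => j _; ring.
  apply: (step_le_integral mE muE mB tB cB) => i z Ez Biz.
  apply: (step_le_integral mE muE mB tB cB) => j t Et Bjt.
  have [->|zt] := eqVneq z t.
    by rewrite subrr cmod0// le0_lneNy ?leey.
  have zt0 : 0 < cmod (z - t) by rewrite cmod_gt0 subr_eq0.
  rewrite lne_EFin// lee_fin lerBlDr.
  apply: le_trans (uc _ _ (rescale L z) (rescale L t) _ _ _ _ _ _) _;
    rewrite ?halfE//; try by rewrite cmodB close.
  have rzt : rescale L z != rescale L t.
    by rewrite -subr_eq0 -rescaleB -cmod_gt0 cmod_rescale// divr_gt0.
  have := logker_le d0 (lt1 _ (halfE _ Ez)) (lt1 _ (halfE _ Et)) rzt.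
  by rewrite -rescaleB cmod_rescale// ln_div ?posrE//; lra.
- move=> w tau wr wt.
  pose v i := logker d (rescale L w) (rescale L (b i)) - ln L + tau + eta.
  have -> : \sum_i m i * logker d (rescale L w) (rescale L (b i))
      - ln L + tau + eta = \sum_i v i * m i.
    rewrite /v; under [RHS]eq_bigr do rewrite -!addrA mulrDl.
    by rewrite big_split /= -mulr_sumr m1 mulr1 -!addrA; congr (_ + _);
      apply: eq_bigr => i _; rewrite mulrC.
  apply: (integral_le_step mE muE mB tB cB) => i t Et Bit.
  have [wt0 ltw] := wt t Et.
  rewrite lne_EFin// lee_fin /v (le_trans ltw)//.
  have ww : cmod (rescale L w - rescale L w) < th.
    by rewrite subrr cmod0.
  have := uc _ _ _ _ (half _ wr) (halfE _ Et) (half _ wr) (halfE _ (Eb i)) ww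
    (close _ _ Bit).
  by lra.
Qed.

End Discretization.

Section SignedEnergy.
Context {R : realType}.

Lemma logkerC (d : R) (x y : CC R) : logker d x y = logker d y x.
Proof.
by rewrite /logker /chord cmodB [(1 - cmod x ^+ 2) * _]mulrC.
Qed.

Lemma logker_signed_energy (n N : nat) (d : R) (X : 'I_n -> CC R)
    (Y : 'I_N -> CC R) (p : 'I_n -> R) (q : 'I_N -> R) :
  0 < d <= 1 -> (forall i, cmod (X i) < 1) -> (forall j, cmod (Y j) < 1) ->
  cmod (\sum_i rc (p i) * X i - \sum_j rc (q j) * Y j) ^+ 2 <=
  \sum_i \sum_k p i * p k * logker d (X i) (X k)
  - 2 * (\sum_i p i * \sum_j q j * logker d (X i) (Y j))
  + \sum_j \sum_k q j * q k * logker d (Y j) (Y k).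
Proof.
move=> d01 X1 Y1.
pose x (i : 'I_(n + N)) := match fintype.split i with inl k => X k | inr k => Y k end.
pose c (i : 'I_(n + N)) := match fintype.split i with inl k => p k | inr k => - q k end.
have xl k : x (lshift N k) = X k by rewrite /x (unsplitK (inl k)).
have xr k : x (rshift n k) = Y k by rewrite /x (unsplitK (inr k)).
have cl k : c (lshift N k) = p k by rewrite /c (unsplitK (inl k)).
have cr k : c (rshift n k) = - q k by rewrite /c (unsplitK (inr k)).
have x1 i : cmod (x i) < 1 by rewrite /x; case: (fintype.split i).
have := logker_positive c x1 d01.
rewrite big_split_ord /=.
under eq_bigr do rewrite cl xl.
under [X in cmod (_ + X)]eq_bigr do rewrite cr xr.
have -> : \sum_(i < N) rc (- q i) * Y i = - \sum_j rc (q j) * Y j.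
  rewrite -sumrN; apply: eq_bigr => j _.
  have -> : rc (- q j) = - rc (q j) by exact: (rmorphN (real_complex R)).
  by rewrite mulNr.
move=> /le_trans; apply; rewrite big_split_ord /=.
under eq_bigr do rewrite big_split_ord /=.
under [X in _ + X]eq_bigr do rewrite big_split_ord /=.
rewrite !big_split /=.
have e1 : \sum_(i < n) \sum_(j < n) c (lshift N i) * c (lshift N j) *
    logker d (x (lshift N i)) (x (lshift N j))
    = \sum_i \sum_k p i * p k * logker d (X i) (X k).
  by apply: eq_bigr => i _; apply: eq_bigr => j _; rewrite !cl !xl.
have e2 : \sum_(i < n) \sum_(j < N) c (lshift N i) * c (rshift n j) *
    logker d (x (lshift N i)) (x (rshift n j))
    = - (\sum_i p i * \sum_j q j * logker d (X i) (Y j)).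
  rewrite -sumrN; apply: eq_bigr => i _; rewrite mulr_sumr -sumrN.
  by apply: eq_bigr => j _; rewrite cl cr xl xr; ring.
have e3 : \sum_(i < N) \sum_(j < n) c (rshift n i) * c (lshift N j) *
    logker d (x (rshift n i)) (x (lshift N j))
    = - (\sum_i p i * \sum_j q j * logker d (X i) (Y j)).
  rewrite exchange_big -sumrN; apply: eq_bigr => i _; rewrite mulr_sumr -sumrN.
  by apply: eq_bigr => j _; rewrite cl cr xl xr logkerC; ring.
have e4 : \sum_(i < N) \sum_(j < N) c (rshift n i) * c (rshift n j) *
    logker d (x (rshift n i)) (x (rshift n j))
    = \sum_j \sum_k q j * q k * logker d (Y j) (Y k).
  by apply: eq_bigr => i _; apply: eq_bigr => j _; rewrite !cr !xr; ring.
by rewrite e1 e2 e3 e4; lra.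
Qed.

End SignedEnergy.

Section NodeEnergy.
Context {R : realType}.

Lemma node_energy (n : nat) (Z : 'I_n.+1 -> CC R) (d L Lambda : R) :
  0 < d -> 1 <= L -> 0 <= Lambda ->
  (forall k, cmod (rescale L (Z k)) <= 2^-1) -> injective Z ->
  0 <= (2 * n + 1)%:R * Lambda +
       \sum_(k < n.+1) \sum_(j < n.+1 | j != k) ln (cmod (Z k - Z j)) ->
  \sum_i \sum_k n.+1%:R^-1 * n.+1%:R^-1 *
      logker d (rescale L (Z i)) (rescale L (Z k))
    <= (1 - ln d + 2 * Lambda) / n.+1%:R + ln L.
Proof.
move=> d0 L1 La0 half inj disc.
have L0 : 0 < L by lra.
have nu0 : 0 < n.+1%:R :> R by [].
have lnL : 0 <= ln L by exact: ln_ge0.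
have lt1 k : cmod (rescale L (Z k)) < 1 by move: (half k) => /le_lt_trans; apply; lra.
have row i : \sum_k logker d (rescale L (Z i)) (rescale L (Z k)) <=
    1 - ln d + n.+1%:R * ln L - \sum_(j < n.+1 | j != i) ln (cmod (Z i - Z j)).
  rewrite (bigD1 i)//= -addrA lerD//.
    by have := logker_diag_le d0 (half i); lra.
  have -> : n.+1%:R * ln L = \sum_(j < n.+1) ln L.
    by rewrite sumr_const card_ord mulr_natl.
  apply: (le_trans (y := \sum_(j < n.+1 | j != i) (ln L - ln (cmod (Z i - Z j))))).
    apply: ler_sum => j ji.
    have ij : Z i - Z j != 0 by rewrite subr_eq0 (inj_eq inj) eq_sym.
    have rij : rescale L (Z i) != rescale L (Z j).
      by rewrite -subr_eq0 -rescaleB -cmod_gt0 cmod_rescale// divr_gt0// cmod_gt0.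
    apply: le_trans (logker_le d0 (lt1 i) (lt1 j) rij) _.
    by rewrite -rescaleB cmod_rescale// ln_div ?posrE ?cmod_gt0//; lra.
  by rewrite sumrB lerD2r [leRHS](bigD1 i)//= lerDr.
under eq_bigr do rewrite -mulr_sumr.
rewrite -mulr_sumr -invfM.
have tot : \sum_i \sum_k logker d (rescale L (Z i)) (rescale L (Z k)) <=
    n.+1%:R * (1 - ln d + n.+1%:R * ln L) + (2 * n + 1)%:R * Lambda.
  apply: le_trans (ler_sum _ (fun i _ => row i)) _.
  by rewrite sumrB sumr_const card_ord mulr_natl; lra.
have n2 : (2 * n + 1)%:R * Lambda <= n.+1%:R * (2 * Lambda).
  by rewrite mulrA ler_wpM2r// -natrM ler_nat; lia.
rewrite mulrC ler_pdivrMr ?mulr_gt0//.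
have -> : ((1 - ln d + 2 * Lambda) / n.+1%:R + ln L) * (n.+1%:R * n.+1%:R)
   = n.+1%:R * (1 - ln d + n.+1%:R * ln L) + n.+1%:R * (2 * Lambda).
  by rewrite mulrDl mulrA divfK ?gt_eqF//; ring.
by lra.
Qed.

End NodeEnergy.

Section MeanEstimate.
Context {R : realType}.
Variables (E : set (CC R)) (g : CC R -> \bar R) (c s : R).
Hypotheses (cE : compact E) (capE : capacity E = 1%E).
Hypotheses (greenE : is_green_function E g) (c0 : 0 < c) (s0 : 0 < s).
Hypothesis s1 : s <= 1.
Hypothesis holderE : forall z : CC R, Omega E (Some z) ->
  (g z <= (c * (dist_to E z) `^ s)%:E)%E.

Lemma robin_of_capacity1 : robin E = 0%E.
Proof.
move: capE; rewrite /capacity -(expeR0 (R := R)) => /expeR_inj /eqP.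
by rewrite eqe_oppLR oppe0 => /eqP.
Qed.

Lemma mean_near_center (Lambda : R) : 0 <= Lambda ->
  exists2 K : R, 0 < K & forall n : nat, (0 < n)%N -> exists beta : CC R,
  forall Z : 'I_n.+1 -> CC R, (forall k, E (Z k)) -> injective Z ->
  0 <= (2 * n + 1)%:R * Lambda +
       \sum_(k < n.+1) \sum_(j < n.+1 | j != k) ln (cmod (Z k - Z j)) ->
  cmod (n.+1%:R^-1 * \sum_k Z k - beta) <= K * Num.sqrt (ln n.+1%:R / n.+1%:R).
Proof.
move=> La0; have c_gt0 := c0; have s_gt0 := s0.
have si0 : 0 < s^-1 by rewrite invr_gt0.
have [rho rho0 Erho] := compact_cmod_bounded cE.
have [mu [muE energyE] gE] := greenE.
pose L := 2 * (rho + 2).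
have rhoL : 2 * (rho + 2) <= L by [].
have L4 : 4 <= L by rewrite /L; lra.
have L0 : 0 < L by lra.
have Li : 0 < L^-1 by rewrite invr_gt0.
pose K2 := (1 + s^-1) + 2 * (4 + 2 * Lambda + 4 * c + L ^+ 2).
have K20 : 0 < K2.
  by rewrite /K2; have := sqr_ge0 L; lra.
exists (L * Num.sqrt K2); first by rewrite mulr_gt0// sqrtr_gt0.
move=> n n0; pose nu : R := n.+1%:R.
have nu2 : 2 <= nu by rewrite /nu ler_nat.
have nu0 : 0 < nu by lra.
pose r := nu `^ (- s^-1); pose d := r / nu; pose eta := nu^-1.
have r0 : 0 < r by exact: powR_gt0.
have rs : r `^ s = nu^-1.
  by rewrite /r -powRrM mulNr mulVf ?gt_eqF// powR_inv1// ltW.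
have lnr : ln r = - s^-1 * ln nu by rewrite /r ln_powR.
have lnnu : 2^-1 <= ln nu.
  have nui : nu^-1 <= 2^-1 by rewrite lef_pV2 ?posrE.
  have := @le_ln1Dx R (nu^-1 - 1); rewrite subrKC lnV ?posrE// => h.
  have nui0 : 0 < nu^-1 by rewrite invr_gt0.
  move: h; rewrite ltrBrDl subrr => /(_ nui0); move: nui.
  by move: (nu^-1) (ln nu) => x y; lra.
have r1 : r <= 1.
  have ln0 : 0 <= ln nu by rewrite (le_trans _ lnnu).
  by rewrite -ler_ln ?posrE// ln1 lnr mulNr oppr_le0 mulr_ge0// ltW.
have d0 : 0 < d by rewrite divr_gt0.
have d1 : d < 1 by rewrite /d ltr_pdivrMr// mul1r; lra.
have lnd : ln d = - (1 + s^-1) * ln nu.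
  by rewrite /d ln_div ?posrE// lnr; ring.
have eta0 : 0 < eta by rewrite invr_gt0.
have d01 : 0 < d <= 1 by rewrite d0 ltW.
have [N [b [m [Eb m0 m1 enb potb]]]] := discretization cE rho0 Erho rhoL muE d01 eta0.
have half w : cmod w <= rho + 2 -> cmod (rescale L w) <= 2^-1.
  exact: (rescale_half rho0 rhoL).
have halfE t : E t -> cmod (rescale L t) <= 2^-1.
  by move=> /Erho tr; apply: half; lra.
have lt1 (w : CC R) : cmod w <= 2^-1 -> cmod w < 1 by move=> /le_lt_trans; apply; lra.
pose tau := d ^+ 2 / (2 * (r / L) ^+ 2).
have tauE : tau = L ^+ 2 / 2 / nu ^+ 2.
  by rewrite /tau /d; field; rewrite !gt_eqF.
pose T := ln L - c * (2 * r) `^ s - tau - eta.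
pose V w := \sum_i m i * logker d (rescale L w) (rescale L (b i)).
have VT w : E w -> T <= V w.
  apply: (potential_lower rho0 Erho rhoL Eb m0 m1 _ (r := r));
    rewrite ?d0 ?d1 ?r0 ?r1//.
  move=> {}w Ow /andP[rw wr] wrho.
  have farw t : E t -> r <= cmod (w - t).
    by move=> Et; rewrite (le_trans rw)// dist_to_le.
  have pot_le : (log_potential mu w <= (V w - ln L + tau + eta)%:E)%E.
    apply: potb => // t Et.
    have wt0 : 0 < cmod (w - t) by rewrite (lt_le_trans r0)// farw.
    split => //.
    have rwt : rescale L w != rescale L t.
      by rewrite -subr_eq0 -rescaleB -cmod_gt0 cmod_rescale// divr_gt0.
    have := logker_ge d0 (lt1 _ (half _ wrho)) (lt1 _ (halfE _ Et)) rwt.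
    rewrite -rescaleB cmod_rescale// ln_div ?posrE//.
    have : d ^+ 2 / (2 * (cmod (w - t) / L) ^+ 2) <= tau.
      rewrite /tau ler_wpM2l ?sqr_ge0// lef_pV2 ?posrE ?mulr_gt0 ?exprn_gt0 ?divr_gt0//.
      have rl : r / L <= cmod (w - t) / L by rewrite ler_pM2r ?invr_gt0// farw.
      have q0 : 0 <= r / L by rewrite divr_ge0 ?ltW.
      have q1 : 0 <= cmod (w - t) / L by rewrite divr_ge0 ?cmod_ge0// ltW.
      by rewrite ler_wpM2l// lerXn2r.
    by lra.
  have := holderE Ow; rewrite gE// robin_of_capacity1 sub0e => gw.
  have : ((- (c * dist_to E w `^ s))%:E <= (V w - ln L + tau + eta)%:E)%E.
    by apply: le_trans pot_le; rewrite EFinN leeNl.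
  rewrite lee_fin.
  have : c * dist_to E w `^ s <= c * (2 * r) `^ s.
    have dist0 : 0 <= dist_to E w by lra.
    have r20 : 0 <= 2 * r by lra.
    by rewrite ler_pM2l// ge0_ler_powR ?nnegrE// ltW.
  by rewrite -/(V w) /T; lra.
exists (\sum_j rc (m j) * b j) => Z EZ injZ disc.
have cZ := node_energy d0 (_ : 1 <= L) La0 (fun k => halfE _ (EZ k)) injZ disc.
have {cZ} := cZ (ltac:(lra)).
have SE := logker_signed_energy (fun=> n.+1%:R^-1) m d01
  (fun k => lt1 _ (halfE _ (EZ k))) (fun j => lt1 _ (halfE _ (Eb j))).
move: SE; rewrite -/nu => SE en1.
set D := cmod (_ - _) in SE.
have cross : T <= \sum_(i < n.+1) nu^-1 * V (Z i).
  rewrite (le_trans (y := \sum_(i < n.+1) nu^-1 * T))//.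
    by rewrite sumr_const card_ord -mulrnAl -[_ *+ _]mulr_natl mulfV ?mul1r// gt_eqF.
  by apply: ler_sum => i _; rewrite ler_wpM2l ?VT// invr_ge0 ltW.
have en2 : \sum_i \sum_j m i * m j * logker d (rescale L (b i)) (rescale L (b j))
    <= ln L + eta.
  by move: enb; rewrite energyE robin_of_capacity1 lee_fin subr_le0.
have DT : D ^+ 2 <= (1 - ln d + 2 * Lambda) * eta + 2 * (c * (2 * r) `^ s) + 2 * tau
    + 3 * eta.
  pose S1 := \sum_i \sum_k nu^-1 / nu *
    logker d (rescale L (Z i)) (rescale L (Z k)).
  pose S2 := \sum_(i < n.+1) nu^-1 * V (Z i).
  pose S3 := \sum_i \sum_j m i * m j * logker d (rescale L (b i)) (rescale L (b j)).
  have {}SE : D ^+ 2 <= S1 - 2 * S2 + S3 := SE.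
  have {}en1 : S1 <= (1 - ln d + 2 * Lambda) * eta + ln L := en1.
  move: SE en1 cross en2; rewrite /T -/S2 -/S3.
  move: (D ^+ 2) S1 S2 S3 (ln d) (ln L) ((2 * r) `^ s) (tau) (eta).
  by move=> D2 S1 S2 S3 lnd' lnL p t e; lra.
have pow : (2 * r) `^ s <= 2 * eta.
  rewrite powRM ?(ltW r0)// rs ler_pM2r//.
  by rewrite -[leRHS]powRr1// ler_powR// ler1n.
have tau_le : tau <= L ^+ 2 / 2 * eta.
  rewrite tauE ler_wpM2l ?divr_ge0 ?sqr_ge0// lef_pV2 ?posrE ?exprn_gt0//.
  by rewrite expr2 ler_peMl ?(ltW nu0)//; lra.
pose A := 4 + 2 * Lambda + 4 * c + L ^+ 2.
have A0 : 0 <= A by rewrite /A; have := sqr_ge0 L; lra.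
have D2 : D ^+ 2 <= K2 * (ln nu / nu).
  have cpow := ler_wpM2l (ltW c_gt0) pow.
  have Aln : A * eta <= 2 * A * ln nu * eta.
    rewrite ler_wpM2r ?(ltW eta0)//.
    have h : 0 <= A * (ln nu - 2^-1) by rewrite mulr_ge0// subr_ge0.
    by lra.
  rewrite -[_ / nu]/(ln nu * eta) /K2 -/A; rewrite /A in Aln *.
  by move: DT; rewrite lnd; lra.
have -> : cmod (n.+1%:R^-1 * \sum_k Z k - \sum_j rc (m j) * b j) = L * D.
  rewrite /D; have -> :
    \sum_i rc nu^-1 * rescale L (Z i) - \sum_j rc (m j) * rescale L (b j)
    = rescale L (n.+1%:R^-1 * \sum_k Z k - \sum_j rc (m j) * b j) :> CC R.
    rewrite rescaleB /rescale !mulr_sumr; congr (_ - _); apply: eq_bigr => i _.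
      have -> : rc nu^-1 = n.+1%:R^-1.
        by rewrite rcV; congr (_^-1); exact: (rmorph_nat (real_complex R)).
      by rewrite mulrCA.
    by rewrite mulrCA.
  by rewrite cmod_rescale// [RHS]mulrC divfK// gt_eqF.
rewrite -mulrA ler_pM2l// -sqrtrM ?(ltW K20)//.
by rewrite -[leLHS]ger0_norm ?cmod_ge0// -sqrtr_sqr ler_wsqrtr.
Qed.

End MeanEstimate.

Theorem corollary2p7 (R : realType) (E : set (CC R)) (g : CC R -> \bar R)
    (c s M : R)
    (compactE : compact E)
    (capE : capacity E = 1%E)
    (symE : [set - z | z in E] = E)
    (greenE : is_green_function E g)
    (c_gt0 : 0 < c)
    (s_gt0 : 0 < s) (s_le1 : s <= 1)
    (holderE : forall z : CC R, Omega E (Some z) ->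
       (g z <= (c * (dist_to E z) `^ s)%:E)%E)
    (M_gt0 : 0 < M) :
  exists C7 : R, 0 < C7 /\
    forall (n : nat) (P : {poly int}) (z : 'I_n -> CC R),
      simple_int_poly n E M P ->
      polyC_of_int R P =
        (lead_coef P)%:~R *: \prod_(k < n) ('X - (z k)%:P) ->
      Num.max M 2 <= n%:R ->
      cmod (n%:R^-1 * \sum_(k < n) z k) <= C7 * Num.sqrt (ln n%:R / n%:R).
Proof.
pose Lambda := ln (Num.max M 1).
have La0 : 0 <= Lambda by rewrite ln_ge0// le_max lexx orbT.
have [K K0 KP] := mean_near_center compactE capE greenE c_gt0 s_gt0 s_le1 holderE La0.
exists K; split => // -[|n] P z PE Pz; rewrite ge_max => /andP[_ n2].
  by move: n2; rewrite lern0.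
have n0 : (0 < n)%N by move: n2; rewrite ler_nat.
have [beta betaP] := KP n n0.
have Ez k : E (z k).
  by have [_ /(_ _ (simple_int_poly_root PE Pz k))[]] := PE.
have injz := simple_int_poly_inj PE Pz.
have disc : 0 <= (2 * n + 1)%:R * Lambda +
    \sum_(k < n.+1) \sum_(j < n.+1 | j != k) ln (cmod (z k - z j)).
  apply: le_trans (discriminant_bound PE Pz) _; rewrite lerD2r ler_wpM2l//.
  have [_ _ lP lM] := PE.
  have A0 : 0 < (`|lead_coef P|%:~R : R) by rewrite -[0]/(0%:~R) ltr_int.
  rewrite ler_ln ?posrE ?lt_max ?M_gt0//.
  by rewrite le_max lM.
have h1 := betaP z Ez injz disc.
have nE k : E (- z k) by rewrite -symE; exists (z k).
have ninj : injective (fun k => - z k) by move=> i j /oppr_inj/injz.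
have ndisc : 0 <= (2 * n + 1)%:R * Lambda +
    \sum_(k < n.+1) \sum_(j < n.+1 | j != k) ln (cmod (- z k - - z j)).
  rewrite (eq_bigr (fun k => \sum_(j < n.+1 | j != k) ln (cmod (z k - z j))))//.
  by move=> k _; apply: eq_bigr => j _; rewrite -opprD cmodN.
have := betaP _ nE ninj ndisc; rewrite sumrN mulrN.
set a := n.+1%:R^-1 * _ in h1 *; set q := K * _ in h1 * => h2.
have aa : cmod (a + a) = 2 * cmod a.
  have -> : a + a = rc 2 * a by rewrite rcD mulrDl mul1r.
  by rewrite cmodM cmod_rc ger0_norm.
have : cmod (a + a) <= cmod (a - beta) + cmod (- a - beta).
  rewrite -[cmod (- a - beta)]cmodN opprD !opprK; apply: le_trans (cmodD _ _).
  by rewrite addrACA addNr addr0.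
rewrite aa; move: h1 h2; move: (cmod a) (cmod (a - beta)) (cmod (- a - beta)) q.
by move=> x y z' q; lra.
Qed.
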